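(* Let $S$ be an operator system in a $C^*$-algebra $A = C^*(S)$. Let $\pi : A \to B(H_\pi)$ be an irreducible representation of $A$ (representing an element of $\hat{A}$). If $\pi$ is a weak peak point for $S$, $\pi$ is a weak boundary representation for $S$, and $\pi|_S$ is pure, then $\pi$ is a boundary representation for $S$.
   Context: All Hilbert spaces are complex; $B(H)$ denotes the bounded linear operators on $H$. CP means completely positive, UCP means unital completely positive. An operator system $S$ in a $C^*$-algebra $A$ is a self-adjoint linear subspace of $A$ containing the identity of $A$ such that $A = C^*(S)$, the $C^*$-algebra generated by $S$. The spectrum $\hat{A}$ is the set of unitary equivalence classes of irreducible representations of $A$ on Hilbert spaces. Weak peak point: $\pi \in \hat{A}$ is a weak peak point for $S$ if there exists $s \in S$ such that (i) $|\langle \pi(s)\xi_\pi, \xi_\pi\rangle| = \|s\|$ for some $\xi_\pi \in H_\pi$ with $\|\xi_\pi\| = 1$; and (ii) for every irreducible representation $\sigma : A \to B(H_\sigma)$ not unitarily equivalent to $\pi$, $|\langle \sigma(s)\xi_\sigma, \xi_\sigma\rangle| < \|s\|$ for all $\xi_\sigma \in H_\sigma$ with $\|\xi_\sigma\| = 1$. Weak boundary representation: an irreducible representation $\pi : A \to B(H_\pi)$ is a weak boundary representation for $S$ if $\pi$ itself is the only UCP extension of $\pi|_S$ to $A$ of the form $V^*\pi(\cdot)V$ with $V : H_\pi \to H_\pi$ an isometry; that is, whenever $V$ is an isometry on $H_\pi$ with $V^*\pi(s)V = \pi(s)$ for all $s \in S$, then $V^*\pi(a)V = \pi(a)$ for all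 $a \in A$. Boundary representation: an irreducible representation $\pi : A \to B(H_\pi)$ is a boundary representation for $S$ if $\pi|_S$ has a unique completely positive extension to $A$, namely $\pi$ itself. Pure: a UCP map $\phi : S \to B(H)$ is pure if whenever $\xi : S \to B(H)$ is CP and $\phi - \xi$ is CP, there exists $0 \le t \le 1$ such that $\xi = t\phi$. *)

(* Defs.v *)
From HB Require Import structures.
From mathcomp Require Import all_boot all_order all_algebra.
From mathcomp Require Import complex.
From mathcomp Require Import boolp classical_sets functions reals.
From mathcomp Require Import topology normedtype.
From mathcomp Require Import ring lra.

Set Implicit Arguments.
Unset Strict Implicit.
Unset Printing Implicit Defensive.

Import Order.TTheory GRing.Theory Num.Theory.
Import numFieldNormedType.Exports.

Local Open Scope classical_set_scope.
Local Open Scope ring_scope.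
Local Open Scope complex_scope.

(* Norms of complex normed modules take their values in R[i], whose order    *)
(* compares only numbers with the same imaginary part: 0 <= c, or            *)
(* `|x| <= c, forces c to be real.                                           *)

HB.mixin Record isHilbert (R : realType) H & CompleteNormedModule R[i] H := {
  dotp : {dot H for (@Num.conj R[i])};
  dotp_norm : forall x : H, dotp x x = `|x| ^+ 2
}.

(* The inner product is linear in its first argument. *)
#[short(type="hilbertType")]
HB.structure Definition Hilbert (R : realType) :=
  {H of isHilbert R H & CompleteNormedModule R[i] H}.

Section Riesz.
Variables (R : realType) (H : hilbertType R).

Lemma dotpC (x y : H) : dotp x y = Num.conj (dotp y x).
Proof. by rewrite [LHS](@hermC _ false Num.conj H dotp) expr0 mul1r. Qed.

Let nr (x : H) : R := complex.Re `|x|.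
Let d (x y : H) : R := complex.Re (dotp x y).

Let nrE x : `|x| = (nr x)%:C.
Proof. by rewrite /nr RRe_real // normr_real. Qed.

Let nr_ge0 x : 0 <= nr x.
Proof. by rewrite -lecR -nrE normr_ge0. Qed.

Let nrD x y : nr (x + y) <= nr x + nr y.
Proof. by rewrite -lecR rmorphD /= -!nrE ler_normD. Qed.

Let nrZ (t : R) x : nr (t%:C *: x) = `|t| * nr x.
Proof.
apply: complexI; rewrite rmorphM /= -!nrE normrZ; congr (_ * _).
by rewrite normc_def /= expr0n addr0 sqrtr_sqr.
Qed.

Let nrN x : nr (- x) = nr x.
Proof. by rewrite /nr normrN. Qed.

Let dxx x : d x x = nr x ^+ 2.
Proof. by rewrite /d dotp_norm nrE -rmorphXn. Qed.

Let dC x y : d x y = d y x.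
Proof. by rewrite /d dotpC; case: (dotp y x). Qed.

Let ReM (t : R) (z : R[i]) : complex.Re (t%:C * z) = t * complex.Re z.
Proof. by case: z => a b; rewrite /= mul0r subr0. Qed.

Let dDl x y z : d (x + y) z = d x z + d y z.
Proof. by rewrite /d linearDl raddfD. Qed.

Let dZl (t : R) x z : d (t%:C *: x) z = t * d x z.
Proof. by rewrite /d linearZl_LR ReM. Qed.

Let nr2D x y : nr (x + y) ^+ 2 = nr x ^+ 2 + 2 * d x y + nr y ^+ 2.
Proof.
rewrite -!dxx dDl ![d _ (x + y)]dC !dDl [d y x]dC; ring.
Qed.

Let nr2Z (t : R) x : nr (t%:C *: x) ^+ 2 = t ^+ 2 * nr x ^+ 2.
Proof. by rewrite nrZ exprMn real_normK ?num_real. Qed.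

Let dNC x y : d x y <= nr x * nr y.
Proof.
have : nr (x + y) ^+ 2 <= (nr x + nr y) ^+ 2.
  by rewrite ler_pXn2r ?nnegrE ?nr_ge0 ?addr_ge0 ?nr_ge0 // nrD.
by rewrite nr2D; lra.
Qed.

Lemma dotp_CauchySchwarz (x y : H) : `|dotp x y| <= `|x| * `|y|.
Proof.
have [->|z0] := eqVneq (dotp x y) 0; first by rewrite normr0 mulr_ge0.
set z := dotp x y in z0 *; pose c := Num.conj z / `|z|.
have c1 : `|c| = 1 by rewrite normf_div norm_conjC normr_id divff // normr_eq0.
have cz : dotp (c *: x) y = `|z|.
  rewrite linearZl_LR /= -/z /c mulrAC -normCKC expr2 mulfK //.
  by rewrite normr_eq0.
have zE : `|z| = (complex.Re `|z|)%:C by rewrite RRe_real // normr_real.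
rewrite zE !nrE -rmorphM lecR -cz; apply: le_trans (dNC _ _) _.
by rewrite /nr normrZ c1 mul1r.
Qed.

Section Functional.
Variable (f : H -> R[i]).
Hypothesis fL : linear_for *%R f.
Variable M : R[i].
Hypothesis fM : forall x, `|f x| <= M * `|x|.

Let F x : R := complex.Re (f x).

Let FD x y : F (x + y) = F x + F y.
Proof. by rewrite /F -[x in f (x + _)]scale1r fL mul1r raddfD. Qed.

Let f0 : f 0 = 0.
Proof. by have := fL 1 0 0; rewrite scale1r addr0 mul1r => /eqP; rewrite -subr_eq subrr => /eqP. Qed.

Let FZ t x : F (t%:C *: x) = t * F x.
Proof. by rewrite /F -[_ *: x]addr0 fL f0 addr0 ReM. Qed.

Let m := complex.Re M.

Let FM x : F x <= m * nr x.
Proof.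
have := fM x; rewrite nrE normc_def lecE => /andP[_].
rewrite mulrC ReM mulrC -/m; apply: le_trans.
apply: le_trans (ler_norm _) _; rewrite -/(F x) /=.
by rewrite -sqrtr_sqr ler_sqrt ?addr_ge0 ?sqr_ge0 // lerDl sqr_ge0.
Qed.

Let J x : R := nr x ^+ 2 - 2 * F x.

Let Jlb x : - m ^+ 2 <= J x.
Proof.
have := FM x; have := sqr_ge0 (nr x - m); rewrite /J; nra.
Qed.

Let JE : has_inf (range J).
Proof.
split; first by exists (J 0), 0.
by exists (- m ^+ 2) => _ [x _ <-].
Qed.

Let d0 := inf (range J).

Let d0J x : d0 <= J x.
Proof. by apply: ge_inf; [case: JE|exists x]. Qed.

Let par x y : nr (x - y) ^+ 2 <= 2 * (J x + J y - 2 * d0).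
Proof.
have := d0J (2^-1%:C *: (x + y)).
rewrite /J nr2Z FZ FD nr2D nr2D nrN.
have -> : d x (- y) = - d x y.
  by rewrite dC -scaleN1r -(rmorph1 (real_complex R)) -rmorphN dZl dC mulN1r.
lra.
Qed.

Let near_min e : 0 < e -> exists x, J x < d0 + e.
Proof.
move=> e0; have [|_ [x _ <-] ?] := @inf_adherent _ (range J) e e0; first exact: JE.
by exists x.
Qed.

Let B (e : R) : set H := [set x | J x < d0 + e].

Let G : set_system H := filter_from [set e | 0 < e] B.

Let GP : ProperFilter G.
Proof.
apply: filter_from_proper; last by move=> e /near_min.
apply: filter_from_filter; first by exists 1 => /=.
move=> i j i0 j0; exists (Num.min i j); first by rewrite /= lt_min i0 j0.
by move=> x; rewrite /B /= => h; split; apply: lt_le_trans h _; rewrite lerD2l ge_min lexx ?orbT.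
Qed.

Let Gcvg : cvg G.
Proof.
have GF : Filter G by case: GP.
apply: (@cauchy_cvg _ G GP); apply: (@cauchy_exP _ _ G GF) => e e0.
have [er e'0] : e = (complex.Re e)%:C /\ 0 < complex.Re e.
  by split; [rewrite RRe_real // gtr0_real|move: e0; rewrite ltcE => /andP[]].
set e' := complex.Re e in er e'0.
have d1 : 0 < e' ^+ 2 / 4 by rewrite divr_gt0 // exprn_gt0.
have [x xB] := near_min d1.
exists x, (e' ^+ 2 / 4) => // y yB; rewrite -ball_normE /= er nrE ltcR.
rewrite -(@ltr_pXn2r _ 2) ?nnegrE ?nr_ge0 ?ltW //.
apply: le_lt_trans (par x y) _; move: yB; rewrite /B /=; lra.
Qed.

Let x0 := lim G.

Let approx (e : R) : 0 < e -> exists2 y, nr (x0 - y) < e & J y < d0 + e.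
Proof.
move=> e0.
have h1 : G (ball x0 e%:C) by apply: Gcvg; apply: nbhsx_ballx; rewrite ltcR.
have h2 : G (B e) by exists e.
have GF : Filter G by case: GP.
have [y [yb yB]] := @filter_ex _ G GP _ (@filterI _ G GF _ _ h1 h2).
by exists y => //; move: yb; rewrite -ball_normE /= nrE ltcR.
Qed.

Let Jx0 : J x0 = d0.
Proof.
apply/eqP; rewrite eq_le d0J andbT; apply/ler_addgt0Pr => e e0.
pose c := 2 * nr x0 + 2 * `|m| + 3.
have c0 : 0 < c by rewrite /c; have := nr_ge0 x0; have := normr_ge0 m; lra.
have r0 : 0 < Num.min 1 (e / c) by rewrite lt_min ltr01 divr_gt0.
have [y yx yJ] := approx r0.
set r := Num.min 1 (e / c) in r0 yx yJ.
have r1 : r <= 1 by rewrite ge_min lexx.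
have rc : r * c <= e by rewrite -ler_pdivlMr // ge_min lexx orbT.
have E : x0 = y + (x0 - y) by rewrite addrC subrK.
have : J x0 <= J y + r * (c - 1).
  have h1 : nr x0 <= nr y + nr (x0 - y) by rewrite {1}E nrD.
  have h2 : nr y <= nr x0 + nr (x0 - y).
    by rewrite -(nrN (x0 - y)) opprB -{1}(subrK x0 y) addrC nrD.
  have h3 : F y - F x0 <= `|m| * nr (x0 - y).
    rewrite -(nrN (x0 - y)) opprB -{1}(subrK x0 y) FD addrK.
    by apply: le_trans (FM _) _; rewrite ler_wpM2r // ler_norm.
  have h4 : `|m| * nr (x0 - y) <= `|m| * r by rewrite ler_wpM2l // ltW.
  rewrite /J /c; have := nr_ge0 y; have := nr_ge0 x0; have := nr_ge0 (x0 - y).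
  nra.
move: yJ; nra.
Qed.

Let crit y : F y = d y x0.
Proof.
have h (t : R) : 0 <= t * (2 * (d y x0 - F y)) + t ^+ 2 * nr y ^+ 2.
  have := d0J (x0 + t%:C *: y); rewrite -Jx0 /J nr2D nr2Z FD FZ.
  by rewrite [d x0 _]dC dZl; lra.
have n0 := sqr_ge0 (nr y).
set g := d y x0 - F y in h.
have [|gn] := eqVneq g 0; first by rewrite /g; lra.
have := h (- g / (nr y ^+ 2 + 1)).
have s0 : 0 < nr y ^+ 2 + 1 by lra.
set s := nr y ^+ 2 + 1 in s0 *.
have -> : nr y ^+ 2 = s - 1 by rewrite /s addrK.
have -> : - g / s * (2 * g) + (- g / s) ^+ 2 * (s - 1) =
   - (g / s) ^+ 2 * (s + 1) by field; rewrite gt_eqF.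
have : 0 < (g / s) ^+ 2 by rewrite exprn_even_gt0 //= mulf_neq0 // invr_neq0 // gt_eqF.
nra.
Qed.

Lemma riesz_representation : exists x, forall y, f y = dotp y x.
Proof.
exists x0 => y; apply/eqP; rewrite eq_complex; apply/andP; split; apply/eqP.
  exact: crit.
have := crit ('i *: y); rewrite /F /d -['i *: y]addr0 fL f0 addr0 addr0.
rewrite linearZl_LR mulrC [_ * dotp _ _]mulrC !ReiNIm.
by move=> /oppr_inj.
Qed.
End Functional.
End Riesz.

(* Unital complex C*-algebras with 1 != 0. The product is a field of the mixin *)
(* since the hierarchy has no join of rings with normed modules over another   *)
(* ring; the canonical algType structure is derived from it below.             *)
HB.mixin Record isCStarAlgebra (R : realType) A & CompleteNormedModule R[i] A := {
  cstar_one : A;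
  cstar_mul : A -> A -> A;
  cstar_mulA : associative cstar_mul;
  cstar_mul1 : left_id cstar_one cstar_mul;
  cstar_mulr1 : right_id cstar_one cstar_mul;
  cstar_mulDl : left_distributive cstar_mul +%R;
  cstar_mulDr : right_distributive cstar_mul +%R;
  cstar_one_neq0 : cstar_one != 0;
  cstar_scaleAl : forall (c : R[i]) a b, c *: cstar_mul a b = cstar_mul (c *: a) b;
  cstar_scaleAr : forall (c : R[i]) a b, c *: cstar_mul a b = cstar_mul a (c *: b);
  star : A -> A;
  starD : forall a b, star (a + b) = star a + star b;
  starZ : forall (c : R[i]) a, star (c *: a) = Num.conj c *: star a;
  starM : forall a b, star (cstar_mul a b) = cstar_mul (star b) (star a);
  starK : involutive star;
  cstar_normM : forall a b, `|cstar_mul a b| <= `|a| * `|b|;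
  cstar_norm : forall a, `|cstar_mul (star a) a| = `|a| ^+ 2
}.

#[short(type="cstarType")]
HB.structure Definition CStarAlgebra (R : realType) :=
  {A of isCStarAlgebra R A & CompleteNormedModule R[i] A}.

Section CStarRing.
Variables (R : realType) (A : cstarType R).

#[non_forgetful_inheritance]
HB.instance Definition _ := GRing.Zmodule_isNzRing.Build A
  cstar_mulA cstar_mul1 cstar_mulr1 cstar_mulDl cstar_mulDr cstar_one_neq0.
#[non_forgetful_inheritance]
HB.instance Definition _ := GRing.Lmodule_isLalgebra.Build R[i] A cstar_scaleAl.
#[non_forgetful_inheritance]
HB.instance Definition _ := GRing.Lalgebra_isAlgebra.Build R[i] A cstar_scaleAr.

End CStarRing.

Definition bounded_linear (R : realType) (H K : hilbertType R) : {pred H -> K} :=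
  [pred f | `[< linear f /\ exists M : R[i], forall x, `|f x| <= M * `|x| >]].

Record bounded_op (R : realType) (H K : hilbertType R) := BoundedOp {
  bop_fun :> H -> K;
  bop_funP : bop_fun \in @bounded_linear R H K
}.

Notation "''B' ( H , K )" := (bounded_op H K)
  (at level 8, H at level 2, K at level 2, format "''B' ( H ,  K )") : type_scope.
Notation "''B' ( H )" := (bounded_op H H)
  (at level 8, H at level 2, format "''B' ( H )") : type_scope.

HB.instance Definition _ (R : realType) (H K : hilbertType R) :=
  [isSub of 'B(H, K) for @bop_fun R H K].
HB.instance Definition _ (R : realType) (H K : hilbertType R) :=
  [Choice of 'B(H, K) by <:].

Section BoundedOpLmodule.
Variables (R : realType) (H K : hilbertType R).

Lemma bounded_linear_submod_closed : submod_closed (@bounded_linear R H K).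
Proof.
split=> [|c f g /asboolP[fL [M fM]] /asboolP[gL [N gN]]]; apply/asboolP; split.
- by move=> a x y; rewrite scaler0 addr0.
- by exists 0 => x; rewrite normr0 mul0r.
- move=> a x y; rewrite !fctE fL gL !scalerDr !scalerA addrACA.
  by rewrite [c * a]mulrC.
- exists (`|c| * M + N) => x; rewrite !fctE mulrDl.
  apply: le_trans (ler_normD _ _) _; apply: lerD (gN x).
  by rewrite normrZ -mulrA ler_wpM2l.
Qed.

HB.instance Definition _ :=
  GRing.isSubmodClosed.Build R[i] (H -> K) (@bounded_linear R H K)
    bounded_linear_submod_closed.
HB.instance Definition _ := [SubChoice_isSubLmodule of 'B(H, K) by <:].

Lemma bop_linear (T : 'B(H, K)) : linear T.
Proof. by have /asboolP[] := bop_funP T. Qed.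

HB.instance Definition _ (T : 'B(H, K)) :=
  GRing.isLinear.Build R[i] H K *:%R T (bop_linear T).

Lemma bop_bounded (T : 'B(H, K)) :
  exists2 M : R[i], 0 <= M & forall x, `|T x| <= M * `|x|.
Proof.
have /asboolP[_ [M TM]] := bop_funP T; exists `|M| => // x.
have Mx0 : 0 <= M * `|x| by apply: le_trans (TM x).
by have := TM x; rewrite -(ger0_norm Mx0) normrM normr_id.
Qed.

Lemma bopP (T U : 'B(H, K)) : T =1 U <-> T = U.
Proof.
split=> [TU|-> //]; apply: val_inj; exact/funext.
Qed.

End BoundedOpLmodule.

Section BoundedOpComp.
Variables (R : realType) (H K L : hilbertType R).

Lemma bop_id_subproof : (id : H -> H) \in @bounded_linear R H H.
Proof. by apply/asboolP; split=> //; exists 1 => x; rewrite mul1r. Qed.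

Definition bop_id : 'B(H) := BoundedOp bop_id_subproof.

Lemma bop_comp_subproof (T : 'B(K, L)) (U : 'B(H, K)) :
  (T \o U) \in @bounded_linear R H L.
Proof.
apply/asboolP; split=> [c x y|]; first by rewrite /= !linearP.
have [[M M0 TM] [N _ UN]] := (bop_bounded T, bop_bounded U).
exists (M * N) => x; rewrite -mulrA; apply: le_trans (TM _) _.
exact: ler_wpM2l (UN x).
Qed.

Definition bop_comp (T : 'B(K, L)) (U : 'B(H, K)) : 'B(H, L) :=
  BoundedOp (bop_comp_subproof T U).

End BoundedOpComp.

Section BoundedOpRing.
Variables (R : realType) (H : hilbertType R).

Local Notation comp := (@bop_comp R H H H).

Lemma bop_compA : associative comp.
Proof. by move=> T U V; apply/bopP. Qed.

Lemma bop_comp1 : left_id (bop_id H) comp.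
Proof. by move=> T; apply/bopP. Qed.

Lemma bop_compr1 : right_id (bop_id H) comp.
Proof. by move=> T; apply/bopP. Qed.

Lemma bop_compDl : left_distributive comp +%R.
Proof. by move=> T U V; apply/bopP. Qed.

Lemma bop_compDr : right_distributive comp +%R.
Proof. by move=> T U V; apply/bopP => x; exact: raddfD. Qed.

(* Only a pzRingType, since H may be 0. *)
HB.instance Definition _ := GRing.Zmodule_isPzRing.Build 'B(H)
  bop_compA bop_comp1 bop_compr1 bop_compDl bop_compDr.

End BoundedOpRing.

Section Adjoint.
Variables (R : realType) (H K : hilbertType R).

Lemma dotp_injr (x y : H) : (forall z, dotp z x = dotp z y) -> x = y.
Proof.
move=> xy; suff : `|x - y| ^+ 2 == 0.
  by rewrite sqrf_eq0 normr_eq0 subr_eq0 => /eqP.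
by rewrite -dotp_norm linearBr subr_eq0; apply/eqP/xy.
Qed.

Definition adjoint (T : 'B(H, K)) : 'B(K, H) :=
  xget 0 [set U : 'B(K, H) | forall x y, dotp (T x) y = dotp x (U y)].

Lemma adjointP (T : 'B(H, K)) x y : dotp (T x) y = dotp x (adjoint T y).
Proof.
rewrite /adjoint; case: xgetP => [U _ /(_ x y) //|noU]; exfalso.
have [M M0 TM] := bop_bounded T.
have ex y0 : exists u, forall x0, dotp (T x0) y0 = dotp x0 u.
  apply: (@riesz_representation _ _ (fun x0 => dotp (T x0) y0) _ (M * `|y0|)).
    by move=> c a b; rewrite linearP linearPl.
  move=> a; apply: le_trans (dotp_CauchySchwarz _ _) _.
  by rewrite mulrAC ler_wpM2r.
pose U y0 := sval (cid (ex y0)).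
have UP x0 y0 : dotp (T x0) y0 = dotp x0 (U y0) by exact: (svalP (cid (ex y0))).
suff bU : U \in @bounded_linear R K H.
  by apply: (noU (BoundedOp bU)) => ? ?; exact: UP.
apply/asboolP; split.
  by move=> c a b; apply: dotp_injr => z; rewrite !linearPr /= -!UP !linearPr.
exists M => b; have [->|u0] := eqVneq (U b) 0.
  by rewrite normr0 mulr_ge0.
have u1 : 0 < `|U b| by rewrite normr_gt0.
rewrite -(ler_pM2r u1) -expr2 -dotp_norm -UP.
have h : 0 <= dotp (T (U b)) b by rewrite UP dotp_norm exprn_ge0.
rewrite -(ger0_norm h); apply: le_trans (dotp_CauchySchwarz _ _) _.
by rewrite mulrAC ler_wpM2r.
Qed.
End Adjoint.

Definition isometric (R : realType) (H K : hilbertType R) (V : 'B(H, K)) :=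
  forall x, `|V x| = `|x|.

Section Representations.
Variables (R : realType) (A : cstarType R).

Definition representation (H : hilbertType R) (pi : A -> 'B(H)) :=
  [/\ linear pi, monoid_morphism pi & forall a, pi (star a) = adjoint (pi a)].

Definition irreducible (H : hilbertType R) (pi : A -> 'B(H)) :=
  [/\ representation pi, exists x : H, x != 0 &
    forall M : set H, submod_closed (mem M) -> closed M ->
      (forall a x, M x -> M (pi a x)) -> M = [set 0] \/ M = setT].

Definition unitarily_equivalent (H K : hilbertType R)
    (pi : A -> 'B(H)) (sigma : A -> 'B(K)) :=
  exists U : 'B(H, K), [/\ isometric U, range U = setT &
    forall a, bop_comp U (pi a) = bop_comp (sigma a) U].

Definition cstar_subalgebra (B : set A) :=
  [/\ submod_closed (mem B), {in B &, forall a b, a * b \in B},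
      {in B, forall a, star a \in B} & closed B].

Definition operator_system (S : set A) :=
  [/\ submod_closed (mem S), {in S, forall s, star s \in S}, 1 \in S &
      smallest cstar_subalgebra S = setT].

(* M_n(A) is a C*-algebra, whose positive elements are those of the form Y^* Y. *)
Definition mx_positive n (X : 'M[A]_n) :=
  exists Y : 'M[A]_n, X = map_mx star Y^T *m Y.

(* Positivity of an operator matrix acting on the n-fold direct sum of H. *)
Definition opmx_positive (H : hilbertType R) n (T : 'M['B(H)]_n) :=
  forall x : 'I_n -> H, 0 <= \sum_i \sum_j dotp (T i j (x j)) (x i) :> R[i].

(* A map defined on S is represented by a map defined on A, of which only the *)
(* values on S matter; CP maps on A are the case S = setT.                    *)
Definition completely_positive (S : set A) (H : hilbertType R) (phi : A -> 'B(H)) :=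
  {in S &, forall s t, forall c : R[i], phi (c *: s + t) = c *: phi s + phi t} /\
  forall n (X : 'M[A]_n), (forall i j, X i j \in S) ->
    mx_positive X -> opmx_positive (map_mx phi X).

Definition ucp (S : set A) (H : hilbertType R) (phi : A -> 'B(H)) :=
  completely_positive S phi /\ phi 1 = 1.

Definition pure (S : set A) (H : hilbertType R) (phi : A -> 'B(H)) :=
  ucp S phi /\
  forall xi : A -> 'B(H), completely_positive S xi ->
    completely_positive S (phi \- xi) ->
    exists t : R, 0 <= t <= 1 /\ {in S, forall s, xi s = t%:C *: phi s}.

Definition weak_peak_point (S : set A) (H : hilbertType R) (pi : A -> 'B(H)) :=
  irreducible pi /\
  exists2 s, s \in S &
    (exists2 x : H, `|x| = 1 & `|dotp (pi s x) x| = `|s|) /\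
    (forall (K : hilbertType R) (sigma : A -> 'B(K)), irreducible sigma ->
       ~ unitarily_equivalent pi sigma ->
       forall x : K, `|x| = 1 -> `|dotp (sigma s x) x| < `|s|).

Definition weak_boundary_representation (S : set A) (H : hilbertType R)
    (pi : A -> 'B(H)) :=
  irreducible pi /\
  forall V : 'B(H), isometric V ->
    {in S, forall s, adjoint V * pi s * V = pi s} ->
    forall a, adjoint V * pi a * V = pi a.

Definition boundary_representation (S : set A) (H : hilbertType R)
    (pi : A -> 'B(H)) :=
  irreducible pi /\
  unique (fun psi : A -> 'B(H) =>
            completely_positive setT psi /\ {in S, psi =1 pi}) pi.

End Representations.

(* Main.v *)
From HB Require Import structures.
Require Import Defs.
From mathcomp Require Import all_boot all_order all_algebra.
From mathcomp Require Import complex.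
From mathcomp Require Import boolp classical_sets functions reals.
From mathcomp Require Import topology normedtype sequences derive.
From mathcomp Require Import ring lra.

Set Implicit Arguments.
Unset Strict Implicit.
Unset Printing Implicit Defensive.

Import Order.TTheory GRing.Theory Num.Theory.
Import numFieldNormedType.Exports.

Local Open Scope classical_set_scope.
Local Open Scope ring_scope.

(** Let E be the set of completely positive extensions of pi|S to A. It is
    convex, and compact for the pointwise convergence of the coefficients
    Re <psi(a)x, y>. If E contained a map other than pi, one of these
    coefficients would take on E a value larger than its value at pi (change y
    into -y if it is smaller), and an extreme point psi of E maximizing that
    coefficient would differ from pi ([cp_extensions_compact],
    [extreme_point_max]).

    Such a psi is pure among the completely positive maps on A
    ([extreme_extension_pure]): if psi = xi + eta, then purity of pi|S gives
    xi = t pi and eta = (1 - t) pi on S, so for 0 < t < 1 both xi/t and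
    eta/(1 - t) lie in E and extremality identifies them with psi. Hence the
    minimal Stinespring dilation psi = V^* sigma V has an irreducible sigma
    ([stinespring_dilation], [irreducible_dilation]). At a peak vector x of s,
    <sigma(s)Vx, Vx> = <psi(s)x, x> = <pi(s)x, x> has modulus |s|, so the peak
    hypothesis yields a unitary U intertwining pi and sigma. Then W = U^* V is
    an isometry with W^* pi W = psi, which agrees with pi on S; as pi is a weak
    boundary representation, psi = pi, a contradiction.

    The space of the dilation is the reproducing kernel Hilbert space of the
    kernel ((a, x), (b, y)) |-> <psi(b^* a)x, y>, whose elements are functions
    on A * H: it is complete by construction, and sigma(c) merely translates
    the argument by c^*. The square of its norm is a supremum of affine
    functions, from which the parallelogram law is immediate, so that the inner
    product comes from the theorem of Jordan and von Neumann. All the bounds on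
    completely positive maps follow from f(c^* c) <= |c|^2 f(1) for positive
    functionals f, that is from the existence of a square root of 1 - h when
    h is self-adjoint and |h| < 1; that root is obtained from the fixed point
    of the contraction y |-> (h + y^2) / 2. *)

(** * Real norms and completeness *)

Section ComplexScalars.
Variable R : realType.

Lemma ReZ (t : R) (z : R[i]) : complex.Re (t%:C%C * z) = t * complex.Re z.
Proof. by case: z => a b; rewrite /= mul0r subr0. Qed.

Lemma normr_Re_le (z : R[i]) : `|complex.Re z| <= complex.Re `|z|.
Proof.
rewrite normc_def /= -sqrtr_sqr ler_sqrt ?addr_ge0 ?sqr_ge0 //.
by rewrite lerDl sqr_ge0.
Qed.

Lemma gt0_complexP (e : R[i]) : 0 < e -> exists2 d : R, 0 < d & e = d%:C%C.
Proof.
move=> e0; exists (complex.Re e); first by move: e0; rewrite ltcE => /andP[].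
by rewrite RRe_real // gtr0_real.
Qed.

Lemma scale_ReIm (V : lmodType R[i]) (a b : R) (v : V) :
  (a +i* b)%C *: v = a%:C%C *: v + 'i%C *: (b%:C%C *: v).
Proof.
rewrite scalerA -scalerDl; congr (_ *: _); apply/eqP; rewrite eq_complex /=.
by rewrite !(mulr0, mul0r, mul1r, addr0, subr0, add0r) !eqxx.
Qed.

Lemma half_scale (V : lmodType R[i]) (x : V) : 2^-1%:C%C *: (x + x) = x.
Proof.
rewrite scalerDr -scalerDl -rmorphD /= -[RHS]scale1r; congr (_ *: _).
by rewrite -(rmorph1 (real_complex R)) /=; congr _%:C%C; field.
Qed.

End ComplexScalars.

Section RealNorm.
Variables (R : realType) (V : normedModType R[i]).
Implicit Types (x y : V).

(** Norms take their values in R[i], whose order is partial and whose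
    comparisons carry an implicit reality condition; inequalities between norms
    are handled as inequalities between these real numbers. *)
Definition rnorm x : R := complex.Re `|x|.

Lemma rnormE x : `|x| = (rnorm x)%:C%C.
Proof. by rewrite /rnorm RRe_real // normr_real. Qed.

Lemma rnorm_ge0 x : 0 <= rnorm x.
Proof. by rewrite -lecR -rnormE normr_ge0. Qed.

Lemma rnormD x y : rnorm (x + y) <= rnorm x + rnorm y.
Proof. by rewrite -lecR rmorphD /= -!rnormE ler_normD. Qed.

Lemma rnormN x : rnorm (- x) = rnorm x.
Proof. by rewrite /rnorm normrN. Qed.

Lemma rnormB x y : rnorm (x - y) <= rnorm x + rnorm y.
Proof. by rewrite -[rnorm y]rnormN rnormD. Qed.

Lemma rdistC x y : rnorm (x - y) = rnorm (y - x).
Proof. by rewrite -rnormN opprB. Qed.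

Lemma rdist_triangle x y z : rnorm (x - z) <= rnorm (x - y) + rnorm (y - z).
Proof. by have := rnormD (x - y) (y - z); rewrite addrA subrK. Qed.

Lemma rnorm0 : rnorm 0 = 0.
Proof. by rewrite /rnorm normr0. Qed.

Lemma rnorm_eq0 x : rnorm x = 0 -> x = 0.
Proof. by move=> x0; apply/eqP; rewrite -normr_eq0 rnormE x0. Qed.

Lemma rnormZ (t : R) x : rnorm (t%:C%C *: x) = `|t| * rnorm x.
Proof.
apply: complexI; rewrite rmorphM /= -!rnormE normrZ; congr (_ * _).
by rewrite normc_def /= expr0n addr0 sqrtr_sqr.
Qed.

Lemma rnormZi x : rnorm ('i%C *: x) = rnorm x.
Proof.
by rewrite /rnorm normrZ normc_def /= expr0n expr1n add0r sqrtr1 mul1r.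
Qed.

End RealNorm.

Section Shrink.
Variables (R : realType) (X : completeNormedModType R[i]) (B : R -> set X).
Hypothesis Bmono : forall e e', e <= e' -> B e `<=` B e'.
Hypothesis Bne : forall e, 0 < e -> B e !=set0.
Hypothesis Bsmall : forall d, 0 < d -> exists2 e, 0 < e &
  forall x y, B e x -> B e y -> rnorm (x - y) < d.

Let G : set_system X := filter_from [set e | 0 < e] B.

Let GF : ProperFilter G.
Proof.
apply: filter_from_proper; last by move=> e /Bne.
apply: filter_from_filter; first by exists 1 => /=.
move=> i j i0 j0; exists (Num.min i j); first by rewrite /= lt_min i0 j0.
by move=> x Bx; split; apply: Bmono Bx; rewrite ge_min lexx ?orbT.
Qed.

(** The sets B e generate a Cauchy filter, so they have a common limit point.
    Both the fixed points and the closest points below are found as limits of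
    approximate solutions, B e being the set of solutions up to e. *)
Lemma shrinking_sets_cvg : exists x, forall d e, 0 < d -> 0 < e ->
  exists2 y, B e y & rnorm (x - y) < d.
Proof.
have FG : Filter G by case: GF.
have Gcvg : cvg G.
  apply: (@cauchy_cvg _ G GF); apply: (@cauchy_exP _ _ G FG) => e e0.
  have [e' e'0 er] := gt0_complexP e0.
  have [d d0 dP] := Bsmall e'0; have [x Bx] := Bne d0.
  exists x, d => // y By; rewrite -ball_normE /= er rnormE ltcR; exact: dP.
exists (lim G) => d e d0 e0.
have h1 : G (ball (lim G) d%:C%C).
  by apply: Gcvg; apply: nbhsx_ballx; rewrite ltcR.
have h2 : G (B e) by exists e.
have [y [yb yB]] := @filter_ex _ G GF _ (@filterI _ G FG _ _ h1 h2).
by exists y => //; move: yb; rewrite -ball_normE /= rnormE ltcR.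
Qed.
End Shrink.

Section ContractionFixpoint.
Variables (R : realType) (X : completeNormedModType R[i]).

(** Two points moved by less than e are at distance at most 2e / (1 - q), so the
    approximate fixed points shrink to a limit; the iterates of 0 show that
    they exist. *)
Lemma contraction_fixpoint (f : X -> X) (r q : R) :
    0 <= r -> 0 <= q < 1 ->
    (forall x, rnorm x <= r -> rnorm (f x) <= r) ->
    (forall x y, rnorm x <= r -> rnorm y <= r ->
       rnorm (f x - f y) <= q * rnorm (x - y)) ->
  exists2 x, rnorm x <= r & f x = x.
Proof.
move=> r0 /andP[q0 q1] fr fq.
pose B e := [set x : X | rnorm x <= r /\ rnorm (f x - x) < e].
have Bmono e e' : e <= e' -> B e `<=` B e'.
  by move=> ee' x [xr xe]; split=> //; apply: lt_le_trans ee'.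
have Bne e : 0 < e -> B e !=set0.
  move=> e0; pose y n := iter n f 0.
  have yr n : rnorm (y n) <= r by elim: n => [|n]; [rewrite rnorm0|exact: fr].
  have yq n : rnorm (f (y n) - y n) <= q ^+ n * rnorm (f 0).
    elim: n => [|n IH]; first by rewrite expr0 mul1r subr0.
    rewrite exprS -mulrA; apply: le_trans (ler_wpM2l q0 IH); exact: fq.
  have [n ne] : exists n, q ^+ n * rnorm (f 0) < e.
    have c0 : 0 < e / (rnorm (f 0) + 1).
      by rewrite divr_gt0 // ltr_pwDr // rnorm_ge0.
    have : q ^+ n @[n --> \oo] --> (0 : R).
      by apply: cvg_expr; rewrite ger0_norm.
    move=> /cvgrPdist_lt/(_ _ c0)[n _ /(_ n (leqnn n))]; rewrite sub0r normrN.
    rewrite ger0_norm ?exprn_ge0 // => qe; exists n.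
    apply: le_lt_trans (_ : _ <= q ^+ n * (rnorm (f 0) + 1)) _.
      by rewrite ler_wpM2l ?exprn_ge0 // lerDl.
    by rewrite -ltr_pdivlMr // ltr_pwDr // rnorm_ge0.
  by exists (y n); split=> //; apply: le_lt_trans ne.
have Bdiff e x y : B e x -> B e y -> (1 - q) * rnorm (x - y) <= 2 * e.
  move=> [xr xe] [yr ye].
  have := rdist_triangle x (f x) y; have := rdist_triangle (f x) (f y) y.
  have := fq _ _ xr yr; rewrite (rdistC x (f x)); nra.
have Bsmall d : 0 < d -> exists2 e, 0 < e &
    forall x y, B e x -> B e y -> rnorm (x - y) < d.
  move=> d0; exists ((1 - q) * d / 4) => [|x y Bx By].
    by rewrite divr_gt0 // mulr_gt0 // subr_gt0.
  have q1' : 0 < 1 - q by lra.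
  have := Bdiff _ _ _ Bx By; rewrite -(ltr_pM2l q1'); nra.
have [x xB] := shrinking_sets_cvg Bmono Bne Bsmall.
have xr : rnorm x <= r.
  apply/ler_addgt0Pr => e e0; have [y [yr _] xy] := xB e 1 e0 ltr01.
  have := rdist_triangle x y 0; rewrite !subr0; lra.
exists x => //; apply/eqP; rewrite -subr_eq0; apply/eqP/rnorm_eq0.
apply/eqP; rewrite eq_le rnorm_ge0 andbT; apply/ler_addgt0Pr => e e0.
have e3 : 0 < e / 3 by rewrite divr_gt0.
have [y [yr ye] xy] := xB _ _ e3 e3.
have := fq _ _ xr yr; have := rdist_triangle (f x) (f y) x.
have := rdist_triangle (f y) y x; rewrite (rdistC y x).
have : q * rnorm (x - y) <= rnorm (x - y) by rewrite ler_piMl ?rnorm_ge0 // ltW.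
lra.
Qed.
End ContractionFixpoint.

(** * Geometry of a Hilbert space *)

Section RealInner.
Variables (R : realType) (H : hilbertType R).
Implicit Types (x y z : H).

Lemma dotpDl x y z : dotp (x + y) z = dotp x z + dotp y z.
Proof. exact: linearDl. Qed.

Lemma dotpBl x y z : dotp (x - y) z = dotp x z - dotp y z.
Proof. exact: linearBl. Qed.

Lemma dotpZl (c : R[i]) x z : dotp (c *: x) z = c * dotp x z.
Proof. exact: linearZl_LR. Qed.

Lemma dotpDr x y z : dotp z (x + y) = dotp z x + dotp z y.
Proof. exact: linearDr. Qed.

Lemma dotpBr x y z : dotp z (x - y) = dotp z x - dotp z y.
Proof. exact: linearBr. Qed.

Lemma dotpZr (c : R[i]) x z : dotp z (c *: x) = Num.conj c * dotp z x.
Proof. by rewrite dotpC dotpZl rmorphM /= -dotpC. Qed.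

Lemma dotp_suml (I : finType) (F : I -> H) z :
  dotp (\sum_i F i) z = \sum_i dotp (F i) z.
Proof.
by apply: (big_morph (fun x => dotp x z)) => [x y|];
  [exact: dotpDl|exact: linear0l].
Qed.

Lemma dotp_sumr (I : finType) (F : I -> H) z :
  dotp z (\sum_i F i) = \sum_i dotp z (F i).
Proof.
by rewrite dotpC dotp_suml rmorph_sum; apply: eq_bigr => i _; rewrite [RHS]dotpC.
Qed.

(** The real part alone determines the inner product: by antilinearity on the
    right, Im <x, y> = Re <x, i y>. *)
Definition rdot x y : R := complex.Re (dotp x y).

Lemma rdotC x y : rdot x y = rdot y x.
Proof. by rewrite /rdot dotpC; case: (dotp y x). Qed.

Lemma rdotxx x : rdot x x = rnorm x ^+ 2.
Proof. by rewrite /rdot dotp_norm rnormE -rmorphXn. Qed.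

Lemma rdotDl x y z : rdot (x + y) z = rdot x z + rdot y z.
Proof. by rewrite /rdot linearDl raddfD. Qed.

Lemma rdotDr x y z : rdot z (x + y) = rdot z x + rdot z y.
Proof. by rewrite ![rdot z _]rdotC rdotDl. Qed.

Lemma rdotNl x y : rdot (- x) y = - rdot x y.
Proof. by rewrite /rdot linearNl raddfN. Qed.

Lemma rdotNr x y : rdot x (- y) = - rdot x y.
Proof. by rewrite rdotC rdotNl rdotC. Qed.

Lemma rdotZl (t : R) x z : rdot (t%:C%C *: x) z = t * rdot x z.
Proof. by rewrite /rdot linearZl_LR ReZ. Qed.

Lemma rdotZr (t : R) x z : rdot x (t%:C%C *: z) = t * rdot x z.
Proof. by rewrite rdotC rdotZl rdotC. Qed.

Lemma rdotZi x z : rdot ('i%C *: x) ('i%C *: z) = rdot x z.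
Proof.
rewrite /rdot linearZl_LR /= dotpC linearZl_LR [in LHS]rmorphM /= [in RHS]dotpC.
by case: (dotp z x) => a b /=; ring.
Qed.

Lemma ImdotE x y : complex.Im (dotp x y) = rdot x ('i%C *: y).
Proof.
rewrite /rdot [dotp x ('i%C *: y)]dotpC linearZl_LR /= dotpC.
by case: (dotp y x) => a b /=; ring.
Qed.

Lemma dotpE x y : dotp x y = (rdot x y +i* rdot x ('i%C *: y))%C.
Proof. by rewrite -ImdotE /rdot; case: (dotp x y). Qed.

Lemma rnorm2D x y :
  rnorm (x + y) ^+ 2 = rnorm x ^+ 2 + 2 * rdot x y + rnorm y ^+ 2.
Proof. by rewrite -!rdotxx rdotDl !rdotDr [rdot y x]rdotC; ring. Qed.

Lemma rdot_inj x y : (forall z, rdot z x = rdot z y) -> x = y.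
Proof.
move=> xy; apply: dotp_injr => z; rewrite [LHS]dotpC [RHS]dotpC !dotpE.
by rewrite ![rdot _ ('i%C *: _)]rdotC ![rdot _ z]rdotC !xy.
Qed.

Lemma rdot_CS x y : `|rdot x y| <= rnorm x * rnorm y.
Proof.
apply: le_trans (normr_Re_le _) _.
by have := dotp_CauchySchwarz x y; rewrite !rnormE -rmorphM lecR.
Qed.

End RealInner.

Section Projection.
Variables (R : realType) (H : hilbertType R) (M : set H).
Hypothesis Mlin : submod_closed (mem M).
Hypothesis Mcl : closed M.

Let MZD (c : R[i]) x y : M x -> M y -> M (c *: x + y).
Proof. by move=> Mx My; apply: set_mem; apply: Mlin.2; exact: mem_set. Qed.

Let M0 : M 0. Proof. by apply: set_mem; exact: Mlin.1. Qed.

Let MZ (c : R[i]) x : M x -> M (c *: x).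
Proof. by move=> Mx; rewrite -[_ *: _]addr0; exact: MZD. Qed.

Let MD x y : M x -> M y -> M (x + y).
Proof. by move=> Mx My; rewrite -[x]scale1r; exact: MZD. Qed.

(** By the parallelogram law applied to z - x and z - y, whose half-sum is
    z minus a point of M, two points of M that almost realize the distance from
    z to M are close to each other. *)
Lemma closest_point (z : H) :
  exists2 p, M p & forall m, M m -> rnorm (z - p) <= rnorm (z - m).
Proof.
pose E := [set rnorm (z - m) | m in M].
have Einf : has_inf E.
  by split; [exists (rnorm (z - 0)), 0|exists 0 => _ [m _ <-]; exact: rnorm_ge0].
pose d := inf E.
have dE m : M m -> d <= rnorm (z - m).
  by move=> Mm; apply: ge_inf; [case: Einf|exists m].
have d0 : 0 <= d by apply: lb_le_inf; [case: Einf|move=> _ [m _ <-];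
  exact: rnorm_ge0].
pose B e := [set m : H | M m /\ rnorm (z - m) ^+ 2 < d ^+ 2 + e].
have Bmono e e' : e <= e' -> B e `<=` B e'.
  by move=> ee' m [Mm me]; split=> //; apply: lt_le_trans me _; rewrite lerD2l.
have Bne e : 0 < e -> B e !=set0.
  move=> e0; have r0 : 0 < Num.min 1 (e / (2 * d + 2)).
    by rewrite lt_min ltr01 divr_gt0 //; lra.
  have [_ [m Mm <-] mr] := inf_adherent r0 Einf.
  exists m; split=> //; move: mr; rewrite -/d; set r := Num.min _ _ in r0 * => mr.
  have r1 : r <= 1 by rewrite ge_min lexx.
  have re : r * (2 * d + 2) <= e.
    by rewrite -ler_pdivlMr ?ge_min ?lexx ?orbT //; lra.
  have := rnorm_ge0 (z - m); nra.
have Bsmall s : 0 < s -> exists2 e, 0 < e &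
    forall x y, B e x -> B e y -> rnorm (x - y) < s.
  move=> s0; exists (s ^+ 2 / 4) => [|x y [Mx xe] [My ye]].
    by rewrite divr_gt0 // exprn_gt0.
  rewrite -(@ltr_pXn2r _ 2) ?nnegrE ?rnorm_ge0 ?ltW //.
  have Mxy : M (2^-1%:C%C *: (x + y)) by apply/MZ/MD.
  have := dE _ Mxy.
  have -> : z - 2^-1%:C%C *: (x + y) = 2^-1%:C%C *: ((z - x) + (z - y)).
    rewrite !scalerDr !scalerN -{1}[z]scale1r addrACA -opprD -scalerDl.
    rewrite -rmorphD /= -[in LHS](rmorph1 (real_complex R)) /=;
      congr (_%:C%C *: _ - _).
    by field.
  rewrite rnormZ ger0_norm ?invr_ge0 // -(@ler_pXn2r _ 2) ?nnegrE ?mulr_ge0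
    ?invr_ge0 ?rnorm_ge0 //.
  rewrite exprMn (rnorm2D (z - x)).
  have -> : x - y = (z - y) + - (z - x) by rewrite opprB [RHS]addrC addrA subrK.
  rewrite (rnorm2D (z - y)) rnormN rdotNr [rdot (z - y) _]rdotC; move: xe ye.
  set a := rnorm _ ^+ 2; set b := rnorm _ ^+ 2; lra.
have [p pB] := shrinking_sets_cvg Bmono Bne Bsmall.
have Mp : M p.
  apply: Mcl => U; rewrite -nbhs_ballE => -[e e0 eU].
  have [e' e'0 er] := gt0_complexP e0.
  have [m [Mm _] pm] := pB _ 1 e'0 ltr01; exists m; split=> //; apply: eU.
  by rewrite -ball_normE /= er rnormE ltcR.
exists p => // m Mm; apply: le_trans _ (dE m Mm).
apply/ler_addgt0Pr => e e0.
have e20 : 0 < e / 2 by rewrite divr_gt0.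
have e30 : 0 < (e / 2) ^+ 2 by rewrite exprn_gt0.
have [y [My ye] py] := pB _ _ e20 e30.
have : rnorm (z - y) <= d + e / 2.
  have de0 : 0 <= d + e / 2 by lra.
  rewrite -(@ler_pXn2r _ 2) ?nnegrE ?rnorm_ge0 //.
  by apply: le_trans (ltW ye) _; nra.
have := rdist_triangle z y p; rewrite (rdistC y p); lra.
Qed.

(** The first order condition for the closest point p: as a function of the real
    number t, |z - p - t m|^2 is minimal at 0. *)
Lemma orthogonal_decomposition (z : H) :
  exists2 p, M p & forall m, M m -> dotp (z - p) m = 0.
Proof.
have [p Mp pmin] := closest_point z; exists p => //.
have ortho m : M m -> rdot (z - p) m = 0.
  move=> Mm; have h (t : R) : 0 <=
    t ^+ 2 * rnorm m ^+ 2 - t * (2 * rdot (z - p) m).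
    have := pmin _ (MD Mp (MZ t%:C%C Mm)).
    rewrite opprD addrA -(@ler_pXn2r _ 2) ?nnegrE ?rnorm_ge0 // (rnorm2D (z - p)).
    rewrite rdotNr rdotZr rnormN rnormZ exprMn real_normK ?num_real //; lra.
  set g := rdot _ _ in h *; set s := rnorm m ^+ 2 + 1.
  have s0 : 0 < s by rewrite /s ltr_wpDl ?sqr_ge0.
  have [//|g0] := eqVneq g 0.
  have := h (g / s); have -> : rnorm m ^+ 2 = s - 1 by rewrite /s addrK.
  have -> : (g / s) ^+ 2 * (s - 1) - g / s * (2 * g) = - ((g / s) ^+ 2 * (s + 1)).
    by field; rewrite gt_eqF.
  rewrite oppr_ge0 leNgt; case/negP; rewrite mulr_gt0 //; last by lra.
  by rewrite exprn_even_gt0 //= mulf_neq0 // invr_neq0 // gt_eqF.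
by move=> m Mm; rewrite dotpE !ortho //; exact: MZ.
Qed.

(** The uniqueness clause makes P computable: it suffices to exhibit a point of M
    whose difference with x is orthogonal to M. *)
Lemma orthogonal_projection : exists P : 'B(H),
  [/\ forall x, M (P x), forall x m, M m -> dotp (x - P x) m = 0 &
      forall x p, M p -> (forall m, M m -> dotp (x - p) m = 0) -> P x = p].
Proof.
pose P z := s2val (cid2 (orthogonal_decomposition z)).
have MP z : M (P z) by exact: s2valP.
have PP z m : M m -> dotp (z - P z) m = 0.
  by move: m; exact: (s2valP' (cid2 (orthogonal_decomposition z))).
have Puniq z p : M p -> (forall m, M m -> dotp (z - p) m = 0) -> P z = p.
  move=> Mp pP; have Md : M (P z - p).
    by rewrite addrC -scaleN1r; apply: MZD.
  apply/eqP; rewrite -subr_eq0 -normr_eq0 -sqrf_eq0 -dotp_norm.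
  have -> : dotp (P z - p) (P z - p) = dotp ((z - p) - (z - P z)) (P z - p).
    by rewrite opprB [z - p + _]addrC addrA subrK.
  by rewrite dotpBl pP // PP // subrr.
have Plin : linear P.
  move=> c x y; apply: Puniq => [|m Mm]; first by apply: MZD.
  have -> : c *: x + y - (c *: P x + P y) = c *: (x - P x) + (y - P y).
    by rewrite scalerBr opprD addrACA.
  by rewrite dotpDl dotpZl !PP // mulr0 addr0.
have Pb x : `|P x| <= 1 * `|x|.
  rewrite mul1r !rnormE lecR -(@ler_pXn2r _ 2) ?nnegrE ?rnorm_ge0 //.
  have {2}-> : x = P x + (x - P x) by rewrite addrC subrK.
  rewrite rnorm2D [rdot (P x) _]rdotC /rdot PP //= mulr0 addr0.
  by rewrite lerDl sqr_ge0.
have bP : P \in @bounded_linear R H H by apply/asboolP; split=> //; exists 1.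
by exists (BoundedOp bP); split.
Qed.
End Projection.

(** * Square roots and positive functionals in a C*-algebra *)

Section CStarTheory.
Variables (R : realType) (A : cstarType R).
Implicit Types (a b c h : A).

Lemma star0 : star (0 : A) = 0.
Proof. by have := starD (0 : A) 0; rewrite addr0 -[LHS]addr0 => /addrI. Qed.

Lemma starN a : star (- a) = - star a.
Proof. by apply/eqP; rewrite -subr_eq0 opprK -starD addNr star0. Qed.

Lemma starMul a b : star (a * b) = star b * star a.
Proof. exact: starM. Qed.

Lemma star1 : star (1 : A) = 1.
Proof. by rewrite -[LHS]mulr1 -[X in _ * X]starK -starMul mulr1 starK. Qed.

Lemma starZr (t : R) a : star (t%:C%C *: a) = t%:C%C *: star a.
Proof. by rewrite starZ; congr (_ *: _); exact: conjc_real. Qed.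

Lemma rnormM a b : rnorm (a * b) <= rnorm a * rnorm b.
Proof. by rewrite -lecR rmorphM /= -!rnormE; exact: cstar_normM. Qed.

Lemma rnorm_starM a : rnorm (star a * a) = rnorm a ^+ 2.
Proof. by apply: complexI; rewrite rmorphXn /= -!rnormE; exact: cstar_norm. Qed.

Lemma rnorm_star a : rnorm (star a) = rnorm a.
Proof.
have le b : rnorm b <= rnorm (star b).
  have [->|b0] := eqVneq b 0; first by rewrite rnorm0 rnorm_ge0.
  have bgt0 : 0 < rnorm b.
    by rewrite lt_def rnorm_ge0 andbT; apply: contra_neq b0; exact: rnorm_eq0.
  by rewrite -(ler_pM2r bgt0) -expr2 -rnorm_starM rnormM.
by have := le (star a); rewrite starK => h; apply/eqP; rewrite eq_le h le.
Qed.

(** If y = (h + y^2) / 2, then (1 - y)^2 = 1 - 2y + y^2 = 1 - h. On the ball of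
    radius |h| < 1 the map y |-> (h + y^2) / 2 is a contraction of ratio |h|. *)
Lemma cstar_sqrt1B h : star h = h -> rnorm h < 1 ->
  exists2 s, star s = s & s * s = 1 - h.
Proof.
move=> hs h1; pose r := rnorm h; pose f y := 2^-1%:C%C *: (h + y * y).
have r0 : 0 <= r by exact: rnorm_ge0.
have fr y : rnorm y <= r -> rnorm (f y) <= r.
  move=> yr; rewrite /f rnormZ ger0_norm ?invr_ge0 //.
  have := rnormD h (y * y); have := rnormM y y; rewrite -/r.
  have := rnorm_ge0 y; rewrite -/r in h1; nra.
have fq x y : rnorm x <= r -> rnorm y <= r ->
    rnorm (f x - f y) <= r * rnorm (x - y).
  move=> xr yr; rewrite /f -scalerBr rnormZ ger0_norm ?invr_ge0 //.
  have -> : h + x * x - (h + y * y) = x * (x - y) + (x - y) * y.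
    by rewrite opprD addrACA subrr add0r mulrBr mulrBl addrA subrK.
  have := rnormD (x * (x - y)) ((x - y) * y).
  have := rnormM x (x - y); have := rnormM (x - y) y.
  have := rnorm_ge0 (x - y); nra.
have rq : 0 <= r < 1 by rewrite r0.
have [y yr fy] := contraction_fixpoint r0 rq fr fq.
(* star y is a fixed point of f as well, and f has only one in the ball *)
have ys : star y = y.
  have fsy : f (star y) = star y.
    by rewrite -[RHS](congr1 star fy) /f starZr starD hs starMul.
  have syr : rnorm (star y) <= r by rewrite rnorm_star.
  have := fq _ _ syr yr; rewrite fsy fy => le.
  apply/eqP; rewrite -subr_eq0; apply/eqP/rnorm_eq0/eqP.
  rewrite eq_le rnorm_ge0 andbT; have := rnorm_ge0 (star y - y).
  rewrite -/r in h1; nra.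
exists (1 - y); first by rewrite starD starN star1 ys.
have yE : h + y * y = y + y.
  by rewrite -[in RHS]fy /f -scalerDr half_scale.
have -> : h = y + y - y * y by rewrite -yE addrK.
by rewrite mulrBl mul1r mulrBr mulr1 !opprB addrACA -opprD [RHS]addrA.
Qed.

(** For t > |c|^2 the element 1 - c^* c / t is a square s^* s, on which g is
    nonnegative; let t tend to |c|^2. Only real scalars are required of g, so
    that real parts of complex functionals are covered. *)
Lemma positive_functional_bound (g : A -> R) c :
  {morph g : x y / x + y} -> (forall (t : R) x, g (t%:C%C *: x) = t * g x) ->
  (forall x, 0 <= g (star x * x)) ->
  g (star c * c) <= rnorm c ^+ 2 * g 1.
Proof.
move=> gD gZ g0.
have g1 : 0 <= g 1 by have := g0 1; rewrite star1 mulr1.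
have le t : rnorm c ^+ 2 < t -> g (star c * c) <= t * g 1.
  move=> ct; have t0 : 0 < t by apply: le_lt_trans ct; exact: sqr_ge0.
  have [||s ss sE] := @cstar_sqrt1B (t^-1%:C%C *: (star c * c)).
  - by rewrite starZr starMul starK.
  - rewrite rnormZ ger0_norm ?invr_ge0 ?ltW // rnorm_starM.
    by rewrite mulrC ltr_pdivrMr // mul1r.
  have := g0 s; rewrite ss sE gD -scaleN1r.
  have -> : (-1 : R[i]) = (-1)%:C%C by rewrite rmorphN rmorph1.
  rewrite !gZ mulN1r subr_ge0 mulrC ler_pdivrMr //.
  by rewrite mulrC.
apply/ler_addgt0Pr => e e0.
have d0 : 0 < e / (g 1 + 1) by rewrite divr_gt0 // ltr_wpDl.
have := le (rnorm c ^+ 2 + e / (g 1 + 1)); rewrite ltrDl => /(_ d0) h.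
apply: le_trans h _; rewrite mulrDl lerD2l mulrAC ler_pdivrMr ?ltr_wpDl //.
by rewrite ler_wpM2l ?ltW // ltrDl.
Qed.

End CStarTheory.

(** * The Jordan-von Neumann theorem *)

Section AdditiveBounded.
Variable R : realType.

(** The additive function g(s) = f(s) - s f(1) vanishes on the integers, hence is
    bounded by its values on [0, 1]; as g(n t) = n g(t), it is 0. *)
Lemma additive_bounded_linear (f : R -> R) (C : R) :
    {morph f : x y / x + y} -> (forall t, 0 <= t <= 1 -> `|f t| <= C) ->
  forall t, f t = t * f 1.
Proof.
move=> fD fC t; pose g s := f s - s * f 1.
have gD : {morph g : x y / x + y} by move=> x y; rewrite /g fD; ring.
have g1 : g 1 = 0 by rewrite /g mul1r subrr.
have g0 : g 0 = 0 by have := gD 0 0; rewrite addr0; lra.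
have gN x : g (- x) = - g x by have := gD x (- x); rewrite subrr g0; lra.
have gMn x n : g (x *+ n) = g x *+ n.
  by elim: n => [|n IH]; rewrite ?mulr0n // !mulrS gD IH.
have gint (m : int) : g m%:~R = 0.
  by case: m => n; rewrite ?NegzE ?mulrNz ?gN -pmulrn gMn g1 mul0rn ?oppr0.
have gC s : `|g s| <= C + `|f 1|.
  have -> : g s = g (s - (Num.floor s)%:~R) by rewrite gD gN gint subr0.
  have /andP[h1 h2] := mem_rg1_floor s.
  set r := s - _; have r01 : 0 <= r <= 1.
    by rewrite subr_ge0 h1 /= lerBlDl ltW // -intrD1.
  rewrite /g; apply: le_trans (ler_normB _ _) _; apply: lerD (fC _ r01) _.
  rewrite normrM ler_piMl // ger0_norm; first by case/andP: r01.
  by case/andP: r01.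
apply/eqP; rewrite -subr_eq0 -/(g t) -normr_eq0 eq_le normr_ge0 andbT leNgt.
apply/negP => gt0; pose n := Num.bound ((C + `|f 1|) / `|g t|).
have C0 : 0 <= C + `|f 1| by apply: le_trans (gC 0).
have : (C + `|f 1|) / `|g t| < n%:R by apply: archi_boundP; rewrite divr_ge0.
rewrite ltr_pdivrMr // mulr_natl -normrMn -gMn ltNge; case/negP; exact: gC.
Qed.

End AdditiveBounded.

Definition parallelogram (R : realType) (V : normedModType R[i]) :=
  forall x y : V, rnorm (x + y) ^+ 2 + rnorm (x - y) ^+ 2 =
                  2 * rnorm x ^+ 2 + 2 * rnorm y ^+ 2.

Section JordanVonNeumann.
Variables (R : realType) (V : normedModType R[i]).
Hypothesis par : parallelogram V.
Implicit Types (x y z : V).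

Let q x := rnorm x ^+ 2.
Definition polar_form x y : R := (rnorm (x + y) ^+ 2 - rnorm (x - y) ^+ 2) / 4.
Local Notation B := polar_form.

Let BC x y : B x y = B y x.
Proof. by rewrite /polar_form [x + y]addrC rdistC. Qed.

Let Bxx x : B x x = q x.
Proof.
rewrite /polar_form subrr rnorm0 expr0n subr0.
by have := par x x; rewrite subrr rnorm0 expr0n addr0 /q; lra.
Qed.

Let B2 x y z : B (x + y) z + B (x - y) z = 2 * B x z.
Proof.
have := par (x + z) y; have := par (x - z) y; rewrite /polar_form.
rewrite ![_ + z + _]addrAC ![_ - z + _]addrAC; lra.
Qed.

Let B0 z : B 0 z = 0.
Proof. by rewrite /polar_form add0r sub0r rnormN subrr mul0r. Qed.

Let B22 x z : B (x + x) z = 2 * B x z.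
Proof. by rewrite -(B2 x x) subrr B0 addr0. Qed.

(** Applied to half-sum and half-difference, the identity [B2] turns into
    additivity. *)
Let BD x y z : B (x + y) z = B x z + B y z.
Proof.
pose h := 2^-1%:C%C : R[i].
have := B2 (h *: (x + y)) (h *: (x - y)) z.
have -> : h *: (x + y) + h *: (x - y) = x.
  by rewrite -scalerDr addrACA subrr addr0 half_scale.
have -> : h *: (x + y) - h *: (x - y) = y.
  by rewrite -scalerBr opprB addrC addrA subrK half_scale.
by move=> ->; rewrite -B22 -scalerDr half_scale.
Qed.

Let BN x z : B (- x) z = - B x z.
Proof. by have := BD x (- x) z; rewrite subrr B0; lra. Qed.

Let B_bound x y : `|B x y| <= rnorm x * (rnorm x + rnorm y).
Proof.
rewrite /polar_form normrM [`|4^-1|]ger0_norm ?invr_ge0 // ler_pdivrMr //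
  subr_sqr.
have h1 : `|rnorm (x + y) - rnorm (x - y)| <= 2 * rnorm x.
  have xx := rnormD x x; rewrite ler_norml.
  have e1 : rnorm (x + y) <= rnorm (x - y) + rnorm (x + x).
    by rewrite (rdistC x y); have := rnormD (y - x) (x + x);
      rewrite addrA subrK addrC.
  have e2 : rnorm (x - y) <= rnorm (x + y) + rnorm (x + x).
    rewrite -[rnorm (x + y)]rnormN; have := rnormD (- (x + y)) (x + x).
    by rewrite opprD [- x - y]addrC -addrA addKr addrC.
  apply/andP; split; lra.
have h2 : `|rnorm (x + y) + rnorm (x - y)| <= 2 * (rnorm x + rnorm y).
  by rewrite ger0_norm ?addr_ge0 ?rnorm_ge0 //; have := rnormD x y;
    have := rnormB x y; lra.
rewrite normrM; apply: le_trans (ler_pM _ _ h1 h2) _ => //; nra.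
Qed.

Let BZ (t : R) x y : B (t%:C%C *: x) y = t * B x y.
Proof.
pose f s := B (s%:C%C *: x) y.
have -> : B x y = f 1 by rewrite /f scale1r.
have fD : {morph f : s s' / s + s'}.
  by move=> s s'; rewrite /f rmorphD /= scalerDl BD.
apply: (@additive_bounded_linear _ f (rnorm x * (rnorm x + rnorm y)) fD).
move=> s /andP[s0 s1]; apply: le_trans (B_bound _ _) _.
have sx : rnorm (s%:C%C *: x) <= rnorm x.
  by rewrite rnormZ ger0_norm // ler_piMl // rnorm_ge0.
by rewrite ler_pM ?addr_ge0 ?rnorm_ge0 // lerD2r.
Qed.

Let Bii x y : B ('i%C *: x) ('i%C *: y) = B x y.
Proof. by rewrite /polar_form -scalerDr -scalerBr !rnormZi. Qed.

Let Bi x y : B ('i%C *: x) y = - B x ('i%C *: y).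
Proof.
by rewrite -Bii scalerA -expr2 sqr_i scaleN1r BN.
Qed.

(** The hypothesis is an argument of the form so that its sesquilinear structure
    can be inferred. *)
Definition jdot of parallelogram V := fun x y =>
  (polar_form x y +i* polar_form x ('i%C *: y))%C.

Local Notation D := (jdot par).

Let DC x y : D x y = Num.conj (D y x).
Proof.
apply/eqP; rewrite eq_complex /= BC eqxx /=; apply/eqP.
by rewrite BC Bi.
Qed.

Let DDl x y z : D (x + y) z = D x z + D y z.
Proof. by rewrite /jdot !BD. Qed.

Let DZl c x y : D (c *: x) y = c * D x y.
Proof.
case: c => a b; rewrite scale_ReIm DDl; apply/eqP; rewrite eq_complex /=.
by rewrite [B ('i%C *: _) y]Bi Bii !BZ; apply/andP; split; apply/eqP; ring.
Qed.

Let DN x : D x x = `|x| ^+ 2.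
Proof.
rewrite rnormE -rmorphXn /jdot Bxx; congr (_ +i* _)%C.
by have := Bi x x; rewrite BC; lra.
Qed.

Lemma jdot_bilinear : bilinear_for *%R (Num.conj \; *%R) D.
Proof.
split=> [y c x z|x c y z] /=; first by rewrite DDl DZl.
by rewrite DC DDl DZl rmorphD rmorphM /= -!DC.
Qed.

Lemma jdot_hermitian x y : D x y = (-1) ^+ false * Num.conj (D y x).
Proof. by rewrite expr0 mul1r -DC. Qed.

Lemma jdot_gt0 x : x != 0 -> 0 < D x x.
Proof. by move=> x0; rewrite DN exprn_gt0 // normr_gt0. Qed.

Lemma jdot_norm x : D x x = `|x| ^+ 2. Proof. exact: DN. Qed.

End JordanVonNeumann.

HB.instance Definition _ (R : realType) (V : normedModType R[i]) (p :
  parallelogram V) :=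
  @bilinear_isBilinear.Build R[i] V V R[i] *%R (Num.conj \;
    *%R) (jdot p) (jdot_bilinear p).
HB.instance Definition _ (R : realType) (V : normedModType R[i]) (p :
  parallelogram V) :=
  @isHermitianSesquilinear.Build R[i] V false Num.conj (jdot p) (jdot_hermitian
    p).
HB.instance Definition _ (R : realType) (V : normedModType R[i]) (p :
  parallelogram V) :=
  @isDotProduct.Build R[i] V (jdot p) (jdot_gt0 p).

(** * Reproducing kernel Hilbert spaces *)

Section Kernel.
Variables (R : realType) (X : Type).
Implicit Types (f g : X -> R[i]) (u v w : seq (R[i] * X)) (c : R[i]).

(** A finite combination of the points of X is a list u of pairs (c, x), and
    stands for the vector that is the sum of the c e_x, where e_x is the vector
    of the kernel at x. The pairing is then the inner product <f, u>, which is
    the sum of the c^* f(x) by the reproducing property f(x) = <f, e_x>. *)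
Definition pairing f u : R[i] := \sum_(p <- u) Num.conj p.1 * f p.2.

Definition scale_comb c u := [seq (c * p.1, p.2) | p <- u].

Lemma pairing_cat f u v : pairing f (u ++ v) = pairing f u + pairing f v.
Proof. exact: big_cat. Qed.

Lemma pairing_scale c f u : pairing f (scale_comb c u) = Num.conj c * pairing f u.
Proof.
rewrite /pairing big_map mulr_sumr; apply: eq_bigr => p _ /=.
by rewrite rmorphM mulrA.
Qed.

Lemma pairing_linear c f g u :
  pairing (c *: f + g) u = c * pairing f u + pairing g u.
Proof.
rewrite /pairing mulr_sumr -big_split; apply: eq_bigr => p _ /=.
by rewrite mulrDr mulrCA.
Qed.

(** The combination u seen as a function on X. *)
Definition comb (k : X -> X -> R[i]) u : X -> R[i] :=
  fun y => \sum_(p <- u) p.1 * k p.2 y.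

Definition psd_kernel (k : X -> X -> R[i]) := forall u, 0 <= pairing (comb k u) u.

Variables (k : X -> X -> R[i]) (kpos : psd_kernel k).

Let h u v := pairing (comb k u) v.

Let N u : R := complex.Re (h u u).

Lemma comb_cat u v : comb k (u ++ v) = comb k u + comb k v.
Proof. by apply/funext => y; rewrite /comb big_cat. Qed.

Lemma comb_scale c u : comb k (scale_comb c u) = c *: comb k u.
Proof.
apply/funext => y; rewrite /comb big_map !fctE scaler_sumr.
by apply: eq_bigr => p _; rewrite /= -mulrA.
Qed.

Let hDl u v w : h (u ++ v) w = h u w + h v w.
Proof. by rewrite /h comb_cat -{1}[comb k u]scale1r pairing_linear mul1r. Qed.

Let hDr u v w : h w (u ++ v) = h w u + h w v.
Proof. exact: pairing_cat. Qed.

Let hZl c u w : h (scale_comb c u) w = c * h u w.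
Proof.
rewrite /h comb_scale -[_ *: _]addr0 pairing_linear.
by rewrite [pairing 0 _]big1 ?addr0 // => p _; rewrite mulr0.
Qed.

Let hZr c u w : h w (scale_comb c u) = Num.conj c * h w u.
Proof. exact: pairing_scale. Qed.

(** The positivity of h u u forces its reality, and h is hermitian by
    polarization. *)
Let hC u v : h v u = Num.conj (h u v).
Proof.
have im0 w : complex.Im (h w w) = 0.
  by have := kpos w; rewrite lecE => /andP[/eqP].
have := im0 (u ++ v); have := im0 (u ++ scale_comb 'i%C v).
rewrite !hDl !hDr !hZl !hZr.
have := im0 u; have := im0 v.
case: (h u v) (h v u) => a b [a' b'] /=.
case: (h u u) (h v v) => p q [p' q'] /= *.
apply/eqP; rewrite eq_complex /=; apply/andP; split; apply/eqP; lra.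
Qed.

Let NE u : h u u = (N u)%:C%C.
Proof.
by have := kpos u; rewrite /N /h lecE;
  case: (pairing _ _) => a b /= /andP[/eqP->].
Qed.

Let N_ge0 u : 0 <= N u.
Proof. by rewrite -lecR -NE; exact: kpos. Qed.

Let ND u v : N (u ++ v) = N u + 2 * complex.Re (h u v) + N v.
Proof.
by rewrite /N hDl !hDr [h v u]hC !raddfD /=; case: (h u v) => a b /=; ring.
Qed.

Let NZ c u : N (scale_comb c u) = complex.Re `|c| ^+ 2 * N u.
Proof.
rewrite /N hZl hZr NE mulrA normc_def; case: c => a b /=.
rewrite sqr_sqrtr ?addr_ge0 ?sqr_ge0 //; ring.
Qed.

Let NZr (t : R) u : N (scale_comb t%:C%C u) = t ^+ 2 * N u.
Proof.
by rewrite NZ normc_def /= expr0n addr0 sqr_sqrtr ?sqr_ge0.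
Qed.

Let cn_ge0 c : 0 <= complex.Re `|c|.
Proof. by have := normr_ge0 c; rewrite lecE => /andP[]. Qed.

Let s u : R := Num.sqrt (N u).

Let s_ge0 u : 0 <= s u. Proof. exact: sqrtr_ge0. Qed.

Let s2 u : s u ^+ 2 = N u. Proof. by rewrite sqr_sqrtr. Qed.

Let sZ c u : s (scale_comb c u) = complex.Re `|c| * s u.
Proof.
by rewrite /s NZ sqrtrM ?sqr_ge0 // sqrtr_sqr ger0_norm // cn_ge0.
Qed.

(** The square root is the seminorm |u| of the combination u, for which f is
    required to be a bounded functional. *)
Definition kbounded : {pred X -> R[i]} := [pred f |
  `[< exists M : R, 0 <= M /\ forall u, complex.Re (pairing f u) <=
      M * Num.sqrt (complex.Re (pairing (comb k u) u)) >]].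

Let ReZpair c f u : complex.Re (c * pairing f u) =
  complex.Re (pairing f (scale_comb (Num.conj c) u)).
Proof. by rewrite pairing_scale conjCK. Qed.

Let norm_conj c : complex.Re `|Num.conj c| = complex.Re `|c|.
Proof. by rewrite norm_conjC. Qed.

Lemma kbounded_submod_closed : submod_closed kbounded.
Proof.
split=> [|c f g /asboolP[M [M0 fM]] /asboolP[M' [M'0 gM]]]; apply/asboolP.
  exists 0; split=> // u; rewrite [pairing 0 _]big1 /= ?mul0r //.
  by move=> p _; rewrite mulr0.
have c0 := cn_ge0 c.
exists (complex.Re `|c| * M + M'); split=> [|u];
  first by rewrite addr_ge0 // mulr_ge0.
rewrite pairing_linear raddfD /= mulrDl lerD // ReZpair.
apply: le_trans (fM _) _; rewrite -/(N _) -/(s _) sZ norm_conj.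
by rewrite mulrCA mulrA.
Qed.

Let J f u := 2 * complex.Re (pairing f u) - N u.

(** The square of the norm of f as a functional. Maximizing 2 Re <f, u> - |u|^2
    over u gives the square of the norm, in a form where the parallelogram law
    amounts to a change of variables. *)
Definition ksqnorm f : R := sup [set 2 * complex.Re (pairing f u) -
  complex.Re (pairing (comb k u) u) | u in setT].
Local Notation q := ksqnorm.

Let qJ f u : f \in kbounded -> J f u <= q f.
Proof.
move=> /asboolP[M [M0 fM]]; apply: sup_upper_bound; last by exists u.
split; first by exists (J f u), u.
exists (M ^+ 2) => _ [v _ <-].
have := fM v; rewrite -/(N _) -/(s _) -s2; have := sqr_ge0 (M - s v); nra.
Qed.

Let q_le f M : (forall u, J f u <= M) -> q f <= M.
Proof.
by move=> fM; apply: ge_sup => [|_ [u _ <-]]; [exists (J f [::]), [::]|exact: fM].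
Qed.

Let pair_nil f : pairing f [::] = 0. Proof. exact: big_nil. Qed.

Let q_ge0 f : f \in kbounded -> 0 <= q f.
Proof.
move=> fb; apply: le_trans (qJ [::] fb).
by rewrite /J /N /h !pair_nil /= mulr0 subr0.
Qed.

Let Re_scale (t : R) f u :
  complex.Re (pairing f (scale_comb t%:C%C u)) = t * complex.Re (pairing f u).
Proof.
by rewrite pairing_scale; case: (pairing f u) => a b /=; ring.
Qed.

(** Optimize the defining inequality of the supremum over the multiples of u. *)
Let q_CS f u : f \in kbounded -> complex.Re (pairing f u) <= Num.sqrt (q f) * s u.
Proof.
move=> fb; set r := complex.Re _.
have Jt (t : R) : t * (2 * r) - t ^+ 2 * N u <= q f.
  by have := qJ (scale_comb t%:C%C u) fb; rewrite /J NZr Re_scale mulrCA.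
have [r0|r0] := leP r 0; first by apply: le_trans r0 _;
  rewrite mulr_ge0 ?sqrtr_ge0.
rewrite -(@ler_pXn2r _ 2) ?nnegrE ?mulr_ge0 ?sqrtr_ge0 ?(ltW r0) //.
rewrite exprMn s2 sqr_sqrtr ?q_ge0 //.
have [N0|N0] := eqVneq (N u) 0.
  have := Jt ((q f + 1) / (2 * r)).
  by rewrite N0 mulr0 subr0 divfK ?mulf_neq0 ?gt_eqF // => h'; exfalso; lra.
have Np : 0 < N u by rewrite lt_def N0 N_ge0.
have := Jt (r / N u).
have -> : r / N u * (2 * r) - (r / N u) ^+ 2 * N u = r ^+ 2 / N u by field.
by rewrite ler_pdivrMr.
Qed.

Let norm_le f (M : R) : 0 <= M ->
  (forall u, complex.Re (pairing f u) <= M * s u) -> Num.sqrt (q f) <= M.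
Proof.
move=> M0 fM; rewrite -(@ler_pXn2r _ 2) ?nnegrE ?sqrtr_ge0 //.
have fb : f \in kbounded by apply/asboolP; exists M.
rewrite sqr_sqrtr ?q_ge0 //; apply: q_le => u.
have := fM u; rewrite /J -s2; have := sqr_ge0 (M - s u); nra.
Qed.

HB.instance Definition _ := GRing.isSubmodClosed.Build R[i] (X -> R[i]) kbounded
  kbounded_submod_closed.

(** The positivity of the kernel is a parameter of the type so that the Hilbert
    space structure can be inferred. *)
Record rkhs (p : psd_kernel k) := Rkhs {
  rkhs_fun :> X -> R[i];
  rkhs_funP : rkhs_fun \in kbounded
}.

Local Notation K := (rkhs kpos).

HB.instance Definition _ := [isSub of K for @rkhs_fun kpos].
HB.instance Definition _ := [Choice of K by <:].
HB.instance Definition _ := [SubChoice_isSubLmodule of K by <:].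

Let nk (f : K) : R := Num.sqrt (q f).

Let nk_ge0 (f : K) : 0 <= nk f. Proof. exact: sqrtr_ge0. Qed.

Let nk_CS (f : K) u : complex.Re (pairing f u) <= nk f * s u.
Proof. exact/q_CS/rkhs_funP. Qed.

Let pairD (f g : K) u : pairing (f + g) u = pairing f u + pairing g u.
Proof. by rewrite -[pairing f u]mul1r -pairing_linear scale1r. Qed.

Let pairZ c (f : K) u : pairing (c *: f) u = c * pairing f u.
Proof.
have := pairing_linear c f 0 u; rewrite addr0 => ->.
by rewrite [pairing 0 _]big1 ?addr0 // => p _; rewrite mulr0.
Qed.

Let nkD (f g : K) : nk (f + g) <= nk f + nk g.
Proof.
apply: norm_le => [|u]; first exact: addr_ge0.
by rewrite pairD raddfD mulrDl /= lerD.
Qed.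

Let nkZ_le c (f : K) : nk (c *: f) <= complex.Re `|c| * nk f.
Proof.
apply: norm_le => [|u]; first by rewrite mulr_ge0.
rewrite pairZ ReZpair; apply: le_trans (nk_CS _ _) _.
by rewrite sZ norm_conj mulrCA mulrA.
Qed.

Let nkZ c (f : K) : nk (c *: f) = complex.Re `|c| * nk f.
Proof.
apply/eqP; rewrite eq_le nkZ_le andTb.
have [->|c0] := eqVneq c 0; first by rewrite normr0 mul0r.
have cp : 0 < complex.Re `|c| by rewrite -ltcR RRe_real ?normr_real ?normr_gt0.
have := nkZ_le c^-1 (c *: f); rewrite scalerA mulVf // scale1r.
have -> : complex.Re `|c^-1| = (complex.Re `|c|)^-1.
  by rewrite normfV -[in LHS](RRe_real (normr_real c)) -fmorphV.
by rewrite mulrC ler_pdivlMr // mulrC.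
Qed.

Let nk_eq0 (f : K) : nk f = 0 -> f = 0.
Proof.
move=> f0; have Re0 u : complex.Re (pairing f u) <= 0.
  by have := nk_CS f u; rewrite f0 mul0r.
have e x : complex.Re (f x) = 0 /\ complex.Im (f x) = 0.
  have Rc c := Re0 [:: (c, x)]; move: (Rc 1) (Rc (-1)) (Rc 'i%C) (Rc (- 'i%C)).
  rewrite /pairing !big_seq1 /=; case: (f x) => a b /=; split; lra.
apply: val_inj; apply/funext => x; have [ea eb] := e x.
by apply/eqP; rewrite eq_complex; apply/andP; split; apply/eqP.
Qed.

Let norm (f : K) : R[i] := (nk f)%:C%C.

Let normD (f g : K) : norm (f + g) <= norm f + norm g.
Proof. by rewrite /norm -rmorphD lecR. Qed.

Let normZ c (f : K) : norm (c *: f) = `|c| * norm f.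
Proof.
by rewrite /norm nkZ rmorphM; congr (_ * _); exact: RRe_real (normr_real c).
Qed.

Let norm_eq0 (f : K) : norm f = 0 -> f = 0.
Proof. by move=> /complexI; exact: nk_eq0. Qed.

HB.instance Definition _ := Lmodule_isNormed.Build R[i] K normD normZ norm_eq0.

Let rnormK (f : K) : rnorm f = nk f.
Proof. by []. Qed.

Let rnorm2K (f : K) : rnorm f ^+ 2 = q f.
Proof. by rewrite rnormK sqr_sqrtr // q_ge0 // rkhs_funP. Qed.

Let pairB (f g : K) u : pairing (f - g) u = pairing f u - pairing g u.
Proof.
by rewrite -scaleN1r addrC -[pairing g u]mul1r -mulNr addrC pairD pairZ.
Qed.

(** For u and v, put f against (u + v)/2 and g against (u - v)/2. *)
Let q_par_le (f g : K) : q (f + g) + q (f - g) <= 2 * q f + 2 * q g.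
Proof.
rewrite -lerBrDr; apply: q_le => u; rewrite lerBrDr addrC -lerBrDr.
apply: q_le => v; rewrite lerBrDr /J pairB pairD !raddfD /= raddfN.
pose t := 2^-1%:C%C : R[i].
have := qJ (scale_comb t (u ++ v)) (rkhs_funP f).
have := qJ (scale_comb t (u ++ scale_comb (-1)%:C%C v)) (rkhs_funP g).
rewrite /J !NZr !ND NZr !Re_scale !pairing_cat !raddfD /= Re_scale.
lra.
Qed.

(** One inequality suffices: the other one is the same inequality for f + g and
    f - g. *)
Lemma rkhs_parallelogram : parallelogram K.
Proof.
move=> f g; rewrite !rnorm2K; apply/eqP; rewrite eq_le q_par_le /=.
have q4 (f' : K) : q (f' + f') = 4 * q f'.
  rewrite -!rnorm2K; have -> : f' + f' = 2%:C%C *: f'.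
    by rewrite -[in LHS](scale1r f') -scalerDl; congr (_ *: _);
      rewrite -(rmorphD (real_complex R) 1 1).
  by rewrite rnormZ exprMn ger0_norm //; lra.
have := q_par_le (f + g) (f - g).
have -> : f + g + (f - g) = f + f by rewrite addrACA subrr addr0.
have -> : f + g - (f - g) = g + g by rewrite opprB addrC addrA subrK.
by rewrite !q4; lra.
Qed.

Let comb_bounded u : comb k u \in kbounded.
Proof.
apply/asboolP; exists (s u); split=> // v; rewrite -/(h u v) -/(N v) -/(s v).
have [vz|v0] := eqVneq (N v) 0.
  rewrite /s vz sqrtr0 mulr0 leNgt; apply/negP => hp.
  (* a t for which the square seminorm of u + t v would be -1 *)
  pose t := - (N u + 1) / (2 * complex.Re (h u v)).
  have := N_ge0 (u ++ scale_comb t%:C%C v); rewrite ND NZr vz mulr0 addr0 hZr.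
  have -> : complex.Re (Num.conj t%:C%C * h u v) = t * complex.Re (h u v).
    by case: (h u v) => a b /=; ring.
  by rewrite mulrCA divfK ?mulf_neq0 ?gt_eqF //; lra.
have Nv : 0 < N v by rewrite lt_def v0 N_ge0.
apply: le_trans (ler_norm _) _.
rewrite -(@ler_pXn2r _ 2) ?nnegrE ?mulr_ge0 // exprMn !s2 real_normK ?num_real //.
(* the t that minimizes the seminorm of u + t v *)
pose t := - (complex.Re (h u v)) / N v.
have := N_ge0 (u ++ scale_comb t%:C%C v); rewrite ND NZr hZr.
have -> : complex.Re (Num.conj t%:C%C * h u v) = t * complex.Re (h u v).
  by case: (h u v) => a b /=; ring.
have -> : N u + 2 * (t * complex.Re (h u v)) + t ^+ 2 * N v =
    N u - complex.Re (h u v) ^+ 2 / N v by rewrite /t; field.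
by rewrite subr_ge0 ler_pdivrMr.
Qed.

Definition rkhs_comb u : K := Rkhs kpos (comb_bounded u).

Let combE u v : pairing (rkhs_comb u) v = h u v. Proof. by []. Qed.

Lemma rkhs_comb_scale c u : rkhs_comb (scale_comb c u) = c *: rkhs_comb u.
Proof. by apply: val_inj; exact: comb_scale. Qed.

(** Complete the square: 2 Re <f + u, v> - |v|^2 is
    2 Re <f, v - u> - |v - u|^2 + 2 Re <f, u> + |u|^2. *)
Let q_comb_le (f : K) u : q (f + rkhs_comb u) <=
  q f + 2 * complex.Re (pairing f u) + N u.
Proof.
apply: q_le => v; rewrite /J pairD combE raddfD /=.
have := qJ (v ++ scale_comb (-1)%:C%C u) (rkhs_funP f).
rewrite /J ND NZr hZr pairing_cat raddfD /= Re_scale [h v u]hC.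
have -> : complex.Re (Num.conj (-1)%:C%C * Num.conj (h u v)) =
  - complex.Re (h u v).
  by case: (h u v) => a b /=; ring.
lra.
Qed.

(** The reverse inequality is [q_comb_le] for f + u and -u. *)
Let q_comb (f : K) u : q (f + rkhs_comb u) =
  q f + 2 * complex.Re (pairing f u) + N u.
Proof.
apply/eqP; rewrite eq_le q_comb_le /=.
have := q_comb_le (f + rkhs_comb u) (scale_comb (-1)%:C%C u).
rewrite rkhs_comb_scale rmorphN rmorph1 scaleN1r addrK pairing_scale pairD combE.
have -> : N (scale_comb (-1) u) = N u.
  by have := NZr (-1) u; rewrite rmorphN rmorph1 sqrrN expr1n mul1r.
rewrite /N; case: (h u u) (pairing f u) => a b [a' b'] /=; lra.
Qed.

Local Notation D := (jdot rkhs_parallelogram).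

Let ReD (f : K) u : complex.Re (D f (rkhs_comb u)) = complex.Re (pairing f u).
Proof.
rewrite /jdot /polar_form /= !rnorm2K q_comb.
have -> : f - rkhs_comb u = f + rkhs_comb (scale_comb (-1)%:C%C u).
  by rewrite rkhs_comb_scale rmorphN rmorph1 scaleN1r.
by rewrite q_comb NZr Re_scale; lra.
Qed.

Lemma jdot_comb (f : K) u : D f (rkhs_comb u) = pairing f u.
Proof.
apply/eqP; rewrite eq_complex ReD eqxx /=; apply/eqP.
have := ReD f (scale_comb 'i%C u); rewrite rkhs_comb_scale => E.
rewrite -[LHS]/(complex.Re (D f ('i%C *: rkhs_comb u))) E pairing_scale.
by case: (pairing f u) => a b /=; ring.
Qed.

Let limit_coord (F : set_system K) (L : K -> R) (M : R) : ProperFilter F ->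
  cauchy F ->
  0 <= M -> (forall f g : K, `|L f - L g| <= M * rnorm (f - g)) ->
  exists l : R, L f @[f --> F] --> l.
Proof.
move=> FF Fc M0 LM; have FG : Filter F by case: FF.
apply/cvg_ex; apply: R_complete; apply: cauchy_exP => e e0.
have e1 : 0 < (e / (M + 1))%:C%C :> R[i] by rewrite ltcR divr_gt0 // ltr_wpDl.
have [f fF] := (cauchyP F).1 Fc _ e1.
exists (L f); rewrite nbhs_simpl /=; apply: filterS fF => g.
rewrite -!ball_normE /= rnormE ltcR => fg.
apply: le_lt_trans (LM _ _) _;
  apply: le_lt_trans (_ : _ <= (M + 1) * rnorm (f - g)) _.
  by rewrite ler_wpM2r ?rnorm_ge0 // lerDl.
by rewrite mulrC -ltr_pdivlMr // ltr_wpDl.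
Qed.

Let coord_le (f g : K) c x :
  `|complex.Re (c * f x) - complex.Re (c * g x)| <=
    s [:: (Num.conj c, x)] * rnorm (f - g).
Proof.
have e (f' : K) : complex.Re (c * f' x) =
  complex.Re (pairing f' [:: (Num.conj c, x)]).
  by rewrite /pairing big_seq1 /= conjCK.
rewrite !e -raddfB /= -pairB rnormK mulrC ler_norml; apply/andP; split;
  last exact: nk_CS.
have := nk_CS (f - g) (scale_comb (-1)%:C%C [:: (Num.conj c, x)]).
by rewrite Re_scale sZ normc_def /= expr0n addr0 sqrrN expr1n sqrtr1 mul1r; lra.
Qed.

(** Evaluations are Lipschitz, so a Cauchy filter converges pointwise; the bounds
    on <g - f, u>, uniform in u, pass to the pointwise limit. *)
Lemma rkhs_complete (F : set_system K) : ProperFilter F -> cauchy F -> cvg F.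
Proof.
move=> FF Fc; have FG : Filter F by case: FF.
have ReL x : exists l : R, complex.Re (f x) @[f --> F] --> l.
  apply: (limit_coord FF Fc (s_ge0 [:: (Num.conj 1, x)])) => f g.
  by have := coord_le f g 1 x; rewrite !mul1r.
have ImL x : exists l : R, complex.Im (f x) @[f --> F] --> l.
  apply: (limit_coord FF Fc (s_ge0 [:: (Num.conj (- 'i%C), x)])) => f g.
  have := coord_le f g (- 'i%C) x; congr (`|_ - _| <= _).
    by case: (f x) => a b /=; ring.
  by case: (g x) => a b /=; ring.
pose l x := (sval (cid (ReL x)) +i* sval (cid (ImL x)))%C.
have lRe x : complex.Re (f x) @[f --> F] --> complex.Re (l x)
  by exact: svalP (cid (ReL x)).
have lIm x : complex.Im (f x) @[f --> F] --> complex.Im (l x)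
  by exact: svalP (cid (ImL x)).
have lp u : complex.Re (pairing f u) @[f --> F] --> complex.Re (pairing l u).
  elim: u => [|[c x] u IH].
    rewrite pair_nil; under eq_fun do rewrite pair_nil; exact: cvg_cst.
  have e f' : complex.Re (pairing f' ((c, x) :: u)) =
      complex.Re c * complex.Re (f' x) + complex.Im c * complex.Im (f' x) +
        complex.Re (pairing f' u).
    by rewrite /pairing big_cons raddfD /=; case: (c) (f' x) => a b [a' b'] /=;
      ring.
  rewrite e; under eq_fun do rewrite e.
  exact: (cvgD (cvgD (cvgM (cvg_cst _) (lRe x)) (cvgM (cvg_cst _) (lIm x))) IH).
have close e (g : K) : 0 <= e -> F [set f | rnorm (g - f) < e] ->
    forall u, complex.Re (pairing l u) - complex.Re (pairing g u) <= e * s u.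
  move=> e0 gF u; apply/ler_addgt0Pr => d d0.
  have /cvgrPdist_lt/(_ _ d0) h1 := lp u.
  have h2 : F [set f : K | `|complex.Re (pairing l u) - complex.Re (pairing f
    u)| < d] by exact: h1.
  have [f [/= fl fg]] := @filter_ex _ F FF _ (@filterI _ F FG _ _ h2 gF).
  have := nk_CS (f - g) u; rewrite -rnormK rdistC pairB raddfB /=.
  have : rnorm (g - f) * s u <= e * s u by rewrite ler_wpM2r // ltW.
  by move: fl; rewrite ltr_norml => /andP[]; lra.
have near_ball (e : R) : 0 < e -> exists g : K, F [set f | rnorm (g - f) < e].
  move=> e0; have e0' : 0 < e%:C%C :> R[i] by rewrite ltcR.
  have [g gF] := (cauchyP F).1 Fc _ e0'; exists g.
  by apply: filterS gF => f; rewrite -ball_normE /= rnormE ltcR.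
have lb : l \in kbounded.
  have [g gF] := near_ball 1 ltr01.
  apply/asboolP; exists (1 + nk g); split=> [|u]; first by rewrite addr_ge0.
  by have := close _ _ ler01 gF u; have := nk_CS g u; rewrite mulrDl;
    rewrite -/(N u) -/(s u); lra.
pose L : K := Rkhs kpos lb.
apply/cvg_ex; exists L => U; rewrite -nbhs_ballE => -[e /= e0 eU].
have [e' e'0 er] := gt0_complexP e0.
have e20 : 0 < e' / 2 by rewrite divr_gt0.
have [g gF] := near_ball _ e20.
have Lg : rnorm (L - g) <= e' / 2.
  rewrite rnormK; apply: norm_le => [|u]; first exact: ltW.
  rewrite pairB raddfB; exact: (close _ g (ltW e20) gF u).
apply: filterS gF => f /= gf; apply: eU; rewrite -ball_normE /= er rnormE ltcR.
have := rdist_triangle L g f; lra.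
Qed.

HB.instance Definition _ := Uniform_isComplete.Build K rkhs_complete.

Let dotK : {dot K for Num.conj} := jdot rkhs_parallelogram.

HB.instance Definition _ :=
  @isHilbert.Build R K dotK (jdot_norm rkhs_parallelogram).

(** For u the single pair (1, x), this is f(x) = <f, e_x>. *)
Lemma dotp_comb (f : K) u : dotp f (rkhs_comb u) = pairing f u.
Proof. exact: jdot_comb. Qed.

Lemma rkhs_norm_le (f : K) (M : R) : 0 <= M ->
    (forall u, complex.Re (pairing f u) <=
       M * Num.sqrt (complex.Re (pairing (comb k u) u))) ->
  rnorm f <= M.
Proof. by move=> M0 fM; rewrite rnormK; exact: norm_le. Qed.

End Kernel.

(** * Extreme points of compact sets of real functions *)

Section ExtremePoints.
Variables (R : realType) (I : eqType).
Local Notation T := {ptws I -> R}.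
Implicit Types (C U : set T) (f g h : T).

Definition convex_comb (t : R) (f g : I -> R) : I -> R :=
  fun i => t * f i + (1 - t) * g i.

Definition extreme_in (C : set (I -> R)) (f : I -> R) := C f /\
  forall t g h, 0 < t < 1 -> C g -> C h -> f = convex_comb t g h ->
    g = f /\ h = f.

Let coord_cont (i : I) : continuous (fun f : T => f i).
Proof. exact: proj_continuous. Qed.

Let coord_max C (i : I) : compact C -> C !=set0 ->
  exists2 f, C f & forall g, C g -> g i <= f i.
Proof.
move=> Cc C0; have := @compact_EVT_max T R (fun f => f i) C C0 Cc.
case=> [|f fC fmax]; first by apply: continuous_subspaceT; exact: coord_cont.
by exists f => [|g Cg]; [exact: set_mem|apply: fmax; exact: mem_set].
Qed.

Let closed_ge (i : I) (M : R) : closed [set f : T | M <= f i].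
Proof.
apply: (@closed_comp _ _ (fun f : T => f i) [set x | M <= x]);
  last exact: closed_ge.
by move=> f _; exact: coord_cont.
Qed.

Let comb_le t a b M : 0 < t < 1 -> a <= M -> b <= M ->
  t * a + (1 - t) * b = M -> a = M /\ b = M :> R.
Proof. move=> /andP[t0 t1] aM bM E; split; nra. Qed.

Let face C U := forall t g h, 0 < t < 1 -> C g -> C h ->
  ~ U (convex_comb t g h) -> ~ U g /\ ~ U h.

(** Zorn's lemma gives a minimal closed face. The points of a face that maximize
    a coordinate form a closed subface, so every coordinate is constant on the
    minimal face, which is a point. Faces are handled through their
    complements U, which grow along chains. *)
Lemma compact_extreme_point C : compact C -> C !=set0 -> exists f, extreme_in C f.
Proof.
move=> Cc C0; have Ccl : closed C.
  by apply: compact_closed => //; apply: hausdorff_product => i;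
    exact: Rhausdorff.
pose P := [set U | [/\ closed (~` U), C `&` ~` U !=set0 & face C U]].
have [F FP Ftot|U [[Ucl [f [Cf Uf]] Uface] Umax]] := @Zorn_bigcup T P.
  have [F0|/set0P[U0 FU0]] := eqVneq F set0.
    rewrite F0 bigcup_set0; split; [by rewrite setC0; exact: closedT| |by []].
    by rewrite setC0 setIT.
  split.
  - rewrite setC_bigcup; apply: closed_bigI => U FU; by have [] := FP _ FU.
  - pose G : set_system T := filter_from F (fun U => C `&` ~` U).
    have GF : ProperFilter G.
      apply: filter_from_proper => [|U FU]; last by have [] := FP _ FU.
      apply: filter_from_filter; first by exists U0.
      move=> U V FU FV; have [UV|VU] := Ftot _ _ FU FV.
        by exists V => // f [Cf Vf]; split; split=> // /UV.
      by exists U => // f [Cf Uf]; split; split=> // /VU.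
    have GC : G C by exists U0 => // f [].
    have [f [Cf clf]] := Cc G GF GC; exists f; split=> // -[U FU Uf].
    have [Ucl _ _] := FP _ FU; apply: (Ucl f) Uf => B Bf.
    by apply: clf Bf; exists U => // g [].
  - move=> t g h t01 Cg Ch nU.
    by split=> -[U FU UU]; have [_ _ Uf] := FP _ FU;
      have [] := Uf t g h t01 Cg Ch _ => // Ugh; apply: nU; exists U.
have uniq_f g h : C g -> ~ U g -> C h -> ~ U h -> forall i, g i <= h i.
  move=> Cg Ug Ch Uh i; rewrite leNgt; apply/negP => hg.
  have cCU : compact (C `&` ~` U) by exact: compact_closedI.
  have [m [Cm Um] mmax] := coord_max i cCU (ex_intro _ f (conj Cf Uf)).
  apply: (Umax (U `|` [set f' | f' i < m i])); first split.
  - by move=> f' ?; left.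
  - move=> sub; apply: Uh; apply: sub; right => /=.
    by apply: lt_le_trans hg _; exact: mmax.
  - split.
    + rewrite setCU; apply: closedI => //.
      have -> : ~` [set f' : T | f' i < m i] = [set f' : T | m i <= f' i].
        by apply/seteqP; split=> f' /=; rewrite leNgt => /negP.
      exact: closed_ge.
    + by exists m; split=> // -[//|/=]; rewrite ltxx.
    + move=> t g' h' t01 Cg' Ch' /not_orP[nU /= nlt].
      have [Ug' Uh'] := Uface _ _ _ t01 Cg' Ch' nU.
      have [eg eh] : g' i = m i /\ h' i = m i.
        apply: (comb_le t01); [exact: mmax|exact: mmax|].
        have lem : t * g' i + (1 - t) * h' i <= m i.
          have := mmax _ (conj Cg' Ug'); have := mmax _ (conj Ch' Uh').
          by case/andP: t01; nra.
        by apply/eqP; rewrite eq_le lem /= leNgt; exact/negP.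
      by split=> -[//|/=]; rewrite ?eg ?eh ltxx.
exists f; split=> // t g h t01 Cg Ch E.
have [Ug Uh] : ~ U g /\ ~ U h by apply: (Uface t) => //; rewrite -E.
by split; apply/funext => i; apply/eqP; rewrite eq_le !uniq_f.
Qed.

(** The maximizers of a coordinate form a face, and an extreme point of a face is
    extreme. *)
Lemma extreme_point_max C (i : I) : compact C -> C !=set0 ->
  exists2 f, extreme_in C f & forall g, C g -> g i <= f i.
Proof.
move=> Cc C0; have [m Cm mmax] := coord_max i Cc C0.
have Cmc : compact (C `&` [set f | m i <= f i]) by exact: compact_closedI.
have [|f [[Cf mf] fext]] := compact_extreme_point Cmc; first by exists m;
  split => /=.
exists f; last by move=> g Cg; apply: le_trans (mmax _ Cg) mf.
split=> // t g h t01 Cg Ch E.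
have fm : f i = m i by apply/eqP; rewrite eq_le mmax.
have [eg eh] : g i = m i /\ h i = m i.
  by apply: (comb_le t01) => //; [exact: mmax|exact: mmax|rewrite -fm E].
by apply: (fext t) => //; split=> //=; rewrite ?eg ?eh.
Qed.

End ExtremePoints.

(** * Completely positive maps *)

Section OperatorValues.
Variables (R : realType) (H K : hilbertType R).
Implicit Types (T U : 'B(H, K)).

Lemma bopDE T U x : (T + U) x = T x + U x. Proof. by []. Qed.
Lemma bopBE T U x : (T - U) x = T x - U x. Proof. by []. Qed.
Lemma bopZE (c : R[i]) T x : (c *: T) x = c *: T x. Proof. by []. Qed.
Lemma bop0E x : (0 : 'B(H, K)) x = 0. Proof. by []. Qed.

Lemma bop_rdotP T U : (forall x y, rdot (T x) y = rdot (U x) y) <-> T = U.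
Proof.
split=> [TU|-> //]; apply/bopP => x; apply: rdot_inj => z.
by rewrite rdotC TU rdotC.
Qed.

End OperatorValues.

Section CompletelyPositive.
Variables (R : realType) (A : cstarType R) (H : hilbertType R).
Implicit Types (phi psi : A -> 'B(H)).

Definition cp_form phi n (a : 'I_n -> A) (x : 'I_n -> H) : R[i] :=
  \sum_i \sum_j dotp (phi (star (a i) * a j) (x j)) (x i).

(** A positive matrix Y^* Y is the sum of the matrices (a_i^* a_j), where a runs
    through the rows of Y; conversely each of these is obtained from a Y with a
    single nonzero row. *)
Lemma completely_positiveE phi : completely_positive setT phi <->
  linear phi /\ forall n a x, 0 <= @cp_form phi n a x.
Proof.
split=> [[phiL phiP]|[phiL phiP]]; split.
- by move=> c s t; apply: phiL; exact: in_setT.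
- case=> [|n] a x; first by rewrite /cp_form big_ord0.
  pose Y : 'M[A]_n.+1 := \matrix_(i, j) if i == ord0 then a j else 0.
  have XE : (\matrix_(i, j) (star (a i) * a j) : 'M[A]_n.+1) =
    map_mx star Y^T *m Y.
    apply/matrixP => i j; rewrite !mxE (bigD1 ord0) //= !mxE eqxx big1 ?addr0 //.
    by move=> k /negPf k0; rewrite !mxE k0 mulr0.
  have := phiP _ (\matrix_(i, j) (star (a i) * a j)) _ (ex_intro _ Y XE) x.
  move=> /(_ (fun i j => in_setT _)); congr (0 <= _).
  by apply: eq_bigr => i _; apply: eq_bigr => j _; rewrite !mxE.
- by move=> s t _ _ c; exact: phiL.
move=> n X _ [Y XE] x.
have phiD : {morph phi : a b / a + b}.
  by move=> a b; rewrite -[a]scale1r phiL !scale1r.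
have phi0 : phi 0 = 0 by have := phiD 0 0; rewrite addr0 -[LHS]addr0 => /addrI.
have -> : \sum_i \sum_j dotp ((map_mx phi X) i j (x j)) (x i) =
    \sum_k cp_form phi (Y k) x.
  rewrite /cp_form [RHS]exchange_big /=; apply: eq_bigr => i _.
  rewrite [RHS]exchange_big /=; apply: eq_bigr => j _.
  rewrite mxE XE mxE (big_morph phi phiD phi0).
  have -> : (\sum_k phi ((map_mx star Y^T) i k * Y k j)) (x j) =
      \sum_k phi ((map_mx star Y^T) i k * Y k j) (x j).
    by apply: (big_morph (fun T : 'B(H) => T (x j))).
  rewrite (big_morph (fun z => dotp z (x i)) (fun a b =>
    dotpDl a b (x i)) (linear0l _ (x i))).
  by apply: eq_bigr => k _; rewrite !mxE.
by apply: sumr_ge0.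
Qed.

End CompletelyPositive.

Section CPBounds.
Variables (R : realType) (A : cstarType R) (H : hilbertType R).
Variable (phi : A -> 'B(H)).
Hypothesis phiCP : completely_positive setT phi.

Lemma cp_linear : linear phi. Proof.
  by have [] := (completely_positiveE phi).1 phiCP. Qed.

Let pos n a x : 0 <= @cp_form _ _ _ phi n a x.
Proof. by have [_ pos] := (completely_positiveE phi).1 phiCP; exact: pos. Qed.

Lemma cpD a b : phi (a + b) = phi a + phi b.
Proof. by rewrite -[a]scale1r cp_linear !scale1r. Qed.

Let phi0 : phi 0 = 0.
Proof. by have := cpD 0 0; rewrite addr0 -[LHS]addr0 => /addrI. Qed.

Lemma cpZ (c : R[i]) a : phi (c *: a) = c *: phi a.
Proof. by rewrite -[c *: a]addr0 cp_linear phi0 addr0. Qed.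

Let pos2 a b x y : 0 <=
  dotp (phi (star a * a) x) x + dotp (phi (star a * b) y) x +
   (dotp (phi (star b * a) x) y + dotp (phi (star b * b) y) y).
Proof.
have := pos (fun i : 'I_2 => if i == ord0 then a else b) (fun i : 'I_2 =>
  if i == ord0 then x else y).
by rewrite /cp_form !big_ord_recl !big_ord0 /= !addr0.
Qed.

Let pos1 a x : 0 <= dotp (phi (star a * a) x) x.
Proof.
have := pos (fun i : 'I_1 => a) (fun i : 'I_1 => x).
by rewrite /cp_form !big_ord_recl !big_ord0 /= !addr0.
Qed.

(** The form of the pair (a, x), (1, y) is real for all x, y, in particular after
    multiplying y by i. *)
Lemma cp_star a x y : dotp (phi (star a) x) y = dotp x (phi a y).
Proof.
have im1 b z : complex.Im (dotp (phi (star b * b) z) z) = 0.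
  by have := pos1 b z; rewrite lecE => /andP[/eqP].
have im2 z : complex.Im (dotp (phi (star a) x) z + dotp (phi a z) x) = 0.
  have := pos2 a 1 z x; rewrite star1 !mul1r mulr1 lecE => /andP[/eqP + _].
  have := im1 1 x; rewrite star1 mulr1 => i1.
  by rewrite !raddfD /= im1 i1; lra.
have := im2 y; have := im2 ('i%C *: y).
rewrite [phi a ('i%C *: y)]linearZ dotpZl dotpZr [dotp x _]dotpC.
case: (dotp (phi (star a) x) y) (dotp (phi a y) x) => p q [p' q'] /= h1 h2.
by apply/eqP; rewrite eq_complex /=; apply/andP; split; apply/eqP; lra.
Qed.

(** Positivity of the form of the pair (a, x), (1, -y), and
    <phi(a^* a)x, x> <= |a|^2 <phi(1)x, x>. *)
Lemma cp_rdot_bound a x y : 2 * rdot (phi a x) y <=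
  rnorm a ^+ 2 * rdot (phi 1 x) x + rdot (phi 1 y) y.
Proof.
have h1 : rdot (phi (star a * a) x) x <= rnorm a ^+ 2 * rdot (phi 1 x) x.
  apply: (@positive_functional_bound _ _ (fun b => rdot (phi b x) x)) =>
    [b c|t b|b].
  - by rewrite cpD bopDE rdotDl.
  - by rewrite cpZ bopZE rdotZl.
  - by have := pos1 b x; rewrite lecE => /andP[].
have := pos2 a 1 x (- y); rewrite star1 !mul1r mulr1.
rewrite cp_star [phi 1 (- y)]raddfN lecE => /andP[_].
rewrite !raddfD /= -!/(rdot _ _) !rdotNr !rdotNl [rdot y _]rdotC; lra.
Qed.

Lemma cp_eq0 : phi 1 = 0 -> phi = (fun=> 0).
Proof.
move=> p1; apply/funext => a; apply/bop_rdotP => x y.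
have := cp_rdot_bound a x y; have := cp_rdot_bound a x (- y).
have z w : rdot (0 : H) w = 0 by rewrite /rdot linear0l.
by rewrite p1 !bop0E rdotNr !z; lra.
Qed.

(** Take y = phi(a)x in [cp_rdot_bound]. *)
Lemma ucp_bound a x : phi 1 = 1 -> rnorm (phi a x) <= rnorm a * rnorm x.
Proof.
move=> p1; have := cp_rdot_bound a x (phi a x); rewrite p1 !rdotxx => h.
rewrite -(@ler_pXn2r _ 2) ?nnegrE ?mulr_ge0 ?rnorm_ge0 // exprMn; lra.
Qed.

End CPBounds.

Section CompletelyPositiveSum.
Variables (R : realType) (A : cstarType R) (H : hilbertType R).
Implicit Types (phi psi : A -> 'B(H)).

Lemma completely_positive_sub (S : set A) phi :
  completely_positive setT phi -> completely_positive S phi.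
Proof.
move=> [pL pP]; split=> [s t _ _ c|n X _]; first by apply: pL; exact: in_setT.
by apply: pP => i j; exact: in_setT.
Qed.

Lemma eq_completely_positive (S : set A) phi psi :
    submod_closed (mem S) -> {in S, phi =1 psi} ->
  completely_positive S phi -> completely_positive S psi.
Proof.
move=> Slin e [pL pP]; split=> [s t sS tS c|n X XS Xpos].
  by rewrite -!e ?pL //; exact: Slin.2.
rewrite (_ : map_mx psi X = map_mx phi X); first exact: pP.
by apply/matrixP => i j; rewrite !mxE e.
Qed.

Lemma completely_positiveZ (t : R) phi : 0 <= t ->
  completely_positive setT phi ->
    completely_positive setT (fun a => t%:C%C *: phi a).
Proof.
move=> t0 /completely_positiveE[pL pP]; apply/completely_positiveE; split.
  by move=> c a b; rewrite pL scalerDr !scalerA mulrC.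
move=> n a x; have -> : cp_form (fun a =>
  t%:C%C *: phi a) a x = t%:C%C * cp_form phi a x.
  rewrite /cp_form mulr_sumr; apply: eq_bigr => i _; rewrite mulr_sumr.
  by apply: eq_bigr => j _; rewrite bopZE dotpZl.
by rewrite mulr_ge0 // lecR.
Qed.

End CompletelyPositiveSum.

(** * Operators defined by real-valued forms *)

Section RealFormOperator.
Variables (R : realType) (H : hilbertType R).

Let sqr_sum_le (p q m : R) : `|p| <= m -> `|q| <= m ->
  p ^+ 2 + q ^+ 2 <= (2 * m) ^+ 2.
Proof.
move=> pm qm; have m0 : 0 <= m by apply: le_trans pm.
have sq r : `|r| <= m -> r ^+ 2 <= m ^+ 2.
  by move=> rm; rewrite -(real_normK (num_real r)) ler_pXn2r ?nnegrE.
have := sq _ pm; have := sq _ qm; have := sqr_ge0 m; rewrite exprMn; lra.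
Qed.

(** The complex linear functional of real part f is y |-> f(y) - i f(i y). *)
Lemma real_riesz (f : H -> R) (M : R) :
    {morph f : y z / y + z} -> (forall t y, f (t%:C%C *: y) = t * f y) ->
    (forall y, `|f y| <= M * rnorm y) ->
  exists z, forall y, f y = rdot z y.
Proof.
move=> fD fZ fM; pose g y : R[i] := (f y +i* - f ('i%C *: y))%C.
have gL : linear_for *%R g.
  case=> a b y z; rewrite /g scalerDr !fD scalerA.
  have -> : ('i * (a +i* b) = (- b) +i* a)%C.
    by apply/eqP; rewrite eq_complex /=; apply/andP; split; apply/eqP; ring.
  have iZ (d : R) : 'i%C *: (d%:C%C *: y) = d%:C%C *: ('i%C *: y).
    by rewrite !scalerA mulrC.
  rewrite !(scale_ReIm a b) (scale_ReIm (- b) a) !iZ !fD !fZ; apply/eqP;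
    rewrite eq_complex /=.
  by apply/andP; split; apply/eqP; ring.
have gM y : `|g y| <= (2 * M)%:C%C * `|y|.
  rewrite rnormE -rmorphM normc_def lecR sqrrN -mulrA.
  have h1 := fM y; have := fM ('i%C *: y); rewrite rnormZi => h2.
  have m0 : 0 <= M * rnorm y by apply: le_trans h1.
  have -> : 2 * (M * rnorm y) = Num.sqrt ((2 * (M * rnorm y)) ^+ 2).
    by rewrite sqrtr_sqr ger0_norm //; exact: mulr_ge0.
  rewrite ler_sqrt ?sqr_ge0 //.
  exact: sqr_sum_le.
have [z gz] := riesz_representation gL gM.
by exists z => y; rewrite rdotC /rdot -gz.
Qed.

(** Pointwise limits of operators are known through the limits of their real
    coefficients; this recovers an operator from such a limit. *)
Lemma real_form_operator (F : H -> H -> R) (M : R) :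
    (forall y, {morph F^~ y : x x' / x + x'}) ->
    (forall t x y, F (t%:C%C *: x) y = t * F x y) ->
    (forall x, {morph F x : y y' / y + y'}) ->
    (forall t x y, F x (t%:C%C *: y) = t * F x y) ->
    (forall x y, F ('i%C *: x) ('i%C *: y) = F x y) ->
    (forall x y, `|F x y| <= M * rnorm x * rnorm y) ->
  exists T : 'B(H), forall x y, F x y = rdot (T x) y.
Proof.
move=> FDl FZl FDr FZr Fi FM.
have ex x : exists z, forall y, F x y = rdot z y.
  by apply: (@real_riesz (F x) (M * rnorm x)).
pose T x := sval (cid (ex x)).
have TE x y : F x y = rdot (T x) y by exact: (svalP (cid (ex x)) y).
have Tu x z : (forall y, F x y = rdot z y) -> T x = z.
  by move=> h; apply: rdot_inj => y; rewrite ![rdot y _]rdotC -TE -h.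
have Tlin : linear T.
  case=> a b x y; apply: Tu => z; rewrite FDl !rdotDl (TE y); congr (_ + _).
  have Ni (v : H) : v = - ('i%C *: ('i%C *: v)).
    by rewrite scalerA -expr2 sqr_i scaleN1r opprK.
  have Fiz v w : F ('i%C *: v) w = - F v ('i%C *: w).
    have Nw : w = (-1)%:C%C *: ('i%C *: ('i%C *: w)).
      by rewrite rmorphN rmorph1 scaleN1r -Ni.
    by rewrite {1}Nw FZr Fi mulN1r.
  have rdiz (v w : H) : rdot ('i%C *: v) w = - rdot v ('i%C *: w).
    by rewrite {1}(Ni w) rdotNr rdotZi.
  by rewrite !(scale_ReIm a b) FDl FZl Fiz FZl rdotDl rdotZl rdiz rdotZl -!TE.
have Tb x : `|T x| <= `|M|%:C%C * `|x|.
  rewrite !rnormE -rmorphM lecR.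
  have [->|Tx0] := eqVneq (rnorm (T x)) 0; first by rewrite mulr_ge0 ?rnorm_ge0.
  have Tp : 0 < rnorm (T x) by rewrite lt_def Tx0 rnorm_ge0.
  rewrite -(ler_pM2r Tp) -expr2 -rdotxx -TE; apply: le_trans (ler_norm _) _.
  apply: le_trans (FM _ _) _; rewrite !ler_wpM2r ?rnorm_ge0 //; exact: ler_norm.
have bT : T \in @bounded_linear R H H by apply/asboolP; split=> //;
  exists `|M|%:C%C.
by exists (BoundedOp bT).
Qed.
End RealFormOperator.

(** * Compactness of the set of completely positive extensions *)

Section ExtensionSpace.
Variables (R : realType) (A : cstarType R) (H : hilbertType R).
Variables (S : set A) (pi : A -> 'B(H)).
Hypotheses (S1 : 1 \in S) (pi1 : pi 1 = 1).

Local Notation I := (A * H * H)%type.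
Local Notation T := {ptws I -> R}.

(** Real coefficients suffice to separate maps, and embed the extensions into a
    product of copies of the real line, where compactness is that of a box. *)
Definition matrix_coefs (phi : A -> 'B(H)) : I -> R :=
  fun p => rdot (phi p.1.1 p.1.2) p.2.

Lemma matrix_coefs_inj phi psi : matrix_coefs phi = matrix_coefs psi -> phi = psi.
Proof.
move=> e; apply/funext => a; apply/bop_rdotP => x y.
exact: (congr1 (fun F => F (a, x, y)) e).
Qed.

Definition cp_extensions : set (A -> 'B(H)) :=
  [set phi | completely_positive setT phi /\ {in S, phi =1 pi}].

Local Notation E := (matrix_coefs @` cp_extensions : set T).

Let coord (p : I) : continuous (fun F : T => F p).
Proof. exact: proj_continuous. Qed.

Let closure_le (u v : T -> R) : continuous u -> continuous v ->
  (forall F, E F -> u F <= v F) -> forall F, closure E F -> u F <= v F.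
Proof.
move=> uc vc uv F.
pose D := [set F : T | 0 <= v F - u F].
have Dc : closed D.
  apply: (@closed_comp _ _ (fun F : T => v F - u F) [set x | 0 <= x]).
    by move=> G _; exact: (cvgB (vc G) (uc G)).
  exact: closed_ge.
have ED : E `<=` D by move=> G /uv; rewrite /D /= subr_ge0.
by move=> /(closureS ED); rewrite -(closure_id D).1 // /D /= subr_ge0.
Qed.

Let closure_eq (u v : T -> R) : continuous u -> continuous v ->
  (forall F, E F -> u F = v F) -> forall F, closure E F -> u F = v F.
Proof.
move=> uc vc uv F EF; apply/eqP; rewrite eq_le.
by apply/andP; split; apply: closure_le EF => // G /uv ->.
Qed.

Let add_cont (u v : T -> R) : continuous u -> continuous v ->
  continuous (fun F => u F + v F).
Proof. by move=> uc vc F; exact: (cvgD (uc F) (vc F)). Qed.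

Let mul_cont (t : R) (u : T -> R) : continuous u -> continuous (fun F => t * u F).
Proof. by move=> uc F; exact: (cvgM (cvg_cst t) (uc F)). Qed.

Let const_cont (c : R) : continuous (fun F : T => c).
Proof. exact: (@cst_continuous T R c). Qed.

Let sum_cont (n : nat) (u : 'I_n -> T -> R) : (forall i, continuous (u i)) ->
  continuous (fun F => \sum_i u i F).
Proof.
elim: n u => [|n IH] u uc.
  by rewrite (_ : (fun F => _) = fun=> 0) //; apply/funext => F; rewrite big_ord0.
rewrite (_ : (fun F => _) = fun F => u ord0 F + \sum_i u (lift ord0 i) F).
  by apply: add_cont => //; apply: IH.
by apply/funext => F; rewrite big_ord_recl.
Qed.

Let ext1 phi : cp_extensions phi -> phi 1 = 1.
Proof. by move=> [_ /(_ _ S1)]; rewrite pi1. Qed.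

Let ext_bound phi p : cp_extensions phi ->
  `|matrix_coefs phi p| <= rnorm p.1.1 * rnorm p.1.2 * rnorm p.2.
Proof.
case: p => [[a x] y] pE; rewrite /matrix_coefs /=.
apply: le_trans (rdot_CS _ _) _; rewrite ler_wpM2r ?rnorm_ge0 //.
by apply: ucp_bound; [case: pE|exact: ext1].
Qed.

(** Being the family of coefficients of a completely positive extension is a
    conjunction of equalities and inequalities between finite sums of
    coordinates, which pass to the closure. *)
Lemma cp_extensions_closed : closed E.
Proof.
move=> F EF.
have FDa a b x y : F (a + b, x, y) = F (a, x, y) + F (b, x, y).
  move: (F) (EF); apply: closure_eq => [||_ [phi pE <-]];
    [exact: coord|exact: add_cont|].
  by rewrite /matrix_coefs /= (cpD pE.1) bopDE rdotDl.
have FZa (t : R) a x y : F (t%:C%C *: a, x, y) = t * F (a, x, y).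
  move: (F) (EF); apply: closure_eq => [||_ [phi pE <-]];
    [exact: coord|exact: mul_cont|].
  by rewrite /matrix_coefs /= (cpZ pE.1) bopZE rdotZl.
have Fia a x y : F ('i%C *: a, x, y) = F (a, 'i%C *: x, y).
  move: (F) (EF); apply: closure_eq => [||_ [phi pE <-]];
    [exact: coord|exact: coord|].
  by rewrite /matrix_coefs /= (cpZ pE.1) bopZE linearZ.
have FDx a y : {morph (fun x => F (a, x, y)) : x x' / x + x'}.
  move=> x x'; move: (F) (EF); apply: closure_eq => [||_ [phi pE <-]];
    [exact: coord|exact: add_cont|].
  by rewrite /matrix_coefs /= raddfD rdotDl.
have FZx a (t : R) x y : F (a, t%:C%C *: x, y) = t * F (a, x, y).
  move: (F) (EF); apply: closure_eq => [||_ [phi pE <-]];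
    [exact: coord|exact: mul_cont|].
  by rewrite /matrix_coefs /= linearZ rdotZl.
have FDy a x : {morph (fun y => F (a, x, y)) : y y' / y + y'}.
  move=> y y'; move: (F) (EF); apply: closure_eq => [||_ [phi pE <-]];
    [exact: coord|exact: add_cont|].
  by rewrite /matrix_coefs /= rdotDr.
have FZy a (t : R) x y : F (a, x, t%:C%C *: y) = t * F (a, x, y).
  move: (F) (EF); apply: closure_eq => [||_ [phi pE <-]];
    [exact: coord|exact: mul_cont|].
  by rewrite /matrix_coefs /= rdotZr.
have Fi a x y : F (a, 'i%C *: x, 'i%C *: y) = F (a, x, y).
  move: (F) (EF); apply: closure_eq => [||_ [phi pE <-]];
    [exact: coord|exact: coord|].
  by rewrite /matrix_coefs /= linearZ rdotZi.
have Fb a x y : `|F (a, x, y)| <= rnorm a * rnorm x * rnorm y.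
  rewrite ler_norml; apply/andP; split.
    move: (F) (EF); apply: closure_le => [||_ [phi pE <-]];
      [exact: const_cont|exact: coord|].
    by have := ext_bound (a, x, y) pE; rewrite ler_norml => /andP[].
  move: (F) (EF); apply: closure_le => [||_ [phi pE <-]];
    [exact: coord|exact: const_cont|].
  by have := ext_bound (a, x, y) pE; rewrite ler_norml => /andP[].
have FS s x y : s \in S -> F (s, x, y) = rdot (pi s x) y.
  move=> sS; move: (F) (EF); apply: closure_eq => [||_ [phi pE <-]];
    [exact: coord|exact: const_cont|].
  by rewrite /matrix_coefs /= pE.2.
have Fpos n (a : 'I_n -> A) (x : 'I_n -> H) :
    0 <= \sum_i \sum_j F (star (a i) * a j, x j, x i).
  move: (F) (EF); apply: closure_le => [||_ [phi pE <-]]; [exact: const_cont| |].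
    by apply: sum_cont => i; apply: sum_cont => j; exact: coord.
  have [_ /(_ n a x)] := (completely_positiveE phi).1 pE.1.
  rewrite /cp_form lecE => /andP[_ h]; apply: le_trans h _.
  rewrite le_eqVlt raddf_sum; apply/orP; left; apply/eqP.
  by apply: eq_bigr => i _; rewrite raddf_sum.
have Fim n (a : 'I_n -> A) (x : 'I_n -> H) :
    \sum_i \sum_j F (star (a i) * a j, x j, 'i%C *: x i) = 0.
  move: (F) (EF); apply: closure_eq => [||_ [phi pE <-]]; [|exact: const_cont|].
    by apply: sum_cont => i; apply: sum_cont => j; exact: coord.
  have [_ /(_ n a x)] := (completely_positiveE phi).1 pE.1.
  rewrite /cp_form lecE raddf_sum => /andP[/eqP h _].
  rewrite -[RHS]/(complex.Im (0 : R[i])) -h.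
  apply: eq_bigr => i _; rewrite raddf_sum; apply: eq_bigr => j _.
  by rewrite /matrix_coefs /= -ImdotE.
have ex a : exists U : 'B(H), forall x y, F (a, x, y) = rdot (U x) y.
  exact: (real_form_operator (FDx a) (FZx a) (FDy a) (FZy a) (Fi a) (Fb a)).
pose phi a := sval (cid (ex a)).
have phiE a x y : F (a, x, y) = rdot (phi a x) y
  by exact: (svalP (cid (ex a)) x y).
exists phi; last by apply/funext => -[[a x] y]; rewrite phiE.
split; last first.
  by move=> s sS; apply/bop_rdotP => x y; rewrite -phiE FS.
apply/completely_positiveE; split.
  case=> p q a b; apply/bop_rdotP => x y.
  rewrite -phiE FDa [(p +i* q)%C *: a]scale_ReIm FDa FZa Fia FZa.
  rewrite bopDE bopZE (scale_ReIm p q) !rdotDl -!phiE rdotZl -phiE;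
    congr (_ + _ + _).
  by rewrite !phiE linearZ /= -rdotZl !scalerA mulrC.
move=> n a x; rewrite lecE /cp_form !raddf_sum /=; apply/andP; split.
  apply/eqP; rewrite -[RHS](Fim n a x); apply: eq_bigr => i _; rewrite raddf_sum.
  by apply: eq_bigr => j _; rewrite phiE -ImdotE.
apply: le_trans (Fpos n a x) _; rewrite le_eqVlt; apply/orP; left; apply/eqP.
apply: eq_bigr => i _; rewrite raddf_sum; apply: eq_bigr => j _.
by rewrite phiE.
Qed.

Lemma cp_extensions_compact : compact E.
Proof.
pose box (p : I) : set R := [set` `[- (rnorm p.1.1 * rnorm p.1.2 * rnorm p.2),
    rnorm p.1.1 * rnorm p.1.2 * rnorm p.2]].
have bc : compact [set F : T | forall p, box p (F p)].
  by apply: tychonoff => p; exact: segment_compact.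
apply: subclosed_compact bc _; first exact: cp_extensions_closed.
move=> _ [phi pE <-] p; rewrite /box /= in_itv /=.
by have := ext_bound p pE; rewrite ler_norml.
Qed.

End ExtensionSpace.

(** * Stinespring dilation *)

Section Compression.
Variables (R : realType) (A : cstarType R) (H K : hilbertType R).
Variables (sigma : A -> 'B(K)) (sigmaR : representation sigma) (V : 'B(H, K)).

Definition compression (B : 'B(K)) : A -> 'B(H) :=
  fun a => bop_comp (adjoint V) (bop_comp B (bop_comp (sigma a) V)).

Lemma dotp_compression B a x y :
  dotp (compression B a x) y = dotp (B (sigma a (V x))) (V y).
Proof. by rewrite dotpC -adjointP -dotpC. Qed.

Lemma representation_dotp a b x y :
  dotp (sigma (star a * b) x) y = dotp (sigma b x) (sigma a y).
Proof.
have [_ [_ sM] sS] := sigmaR; rewrite sM sS.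
by rewrite dotpC -[dotp y _]/(dotp y (adjoint (sigma a) (sigma b x))) -adjointP
  -dotpC.
Qed.

(** With w the sum of the sigma(a_i)V x_i, the form of the compression at (a, x)
    is <B w, w>, as B commutes with sigma. *)
Lemma compression_cp B : (forall a, B * sigma a = sigma a * B) ->
  (forall w, 0 <= dotp (B w) w) -> completely_positive setT (compression B).
Proof.
have [sL [s1 sM] sS] := sigmaR; move=> Bc Bpos; apply/completely_positiveE; split.
  move=> c a b; apply/bopP => x; rewrite bopDE bopZE /= sL.
  by rewrite bopDE bopZE !linearP.
move=> n a x; pose w := \sum_i sigma (a i) (V (x i)).
have -> : cp_form (compression B) a x = dotp (B w) w.
  rewrite /cp_form dotp_sumr; apply: eq_bigr => i _.
  rewrite linear_sum dotp_suml; apply: eq_bigr => j _.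
  rewrite dotp_compression.
  have BE c v : B (sigma c v) = sigma c (B v).
    by have := congr1 (fun U : 'B(K) => U v) (Bc c).
  by rewrite -[RHS]/(dotp (B (sigma (a j) (V (x j)))) _) !BE representation_dotp.
exact: Bpos.
Qed.

End Compression.

Section Stinespring.
Variables (R : realType) (A : cstarType R) (H : hilbertType R).
Variables (psi : A -> 'B(H)).
Hypothesis psiCP : completely_positive setT psi.

Let X := (A * H)%type.

Definition stinespring_kernel (p q : X) : R[i] :=
  dotp (psi (star q.1 * p.1) p.2) q.2.
Local Notation k := stinespring_kernel.

Let mulZl (c : R[i]) (a b : A) : (c *: a) * b = c *: (a * b).
Proof. by rewrite -scalerAl. Qed.

Let mulZr (c : R[i]) (a b : A) : a * (c *: b) = c *: (a * b).
Proof. by rewrite -scalerAr. Qed.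

(** A combination of pairs (a, x) with coefficients c has the same form as the
    family of the pairs (c a, x). *)
Let gram_cp (b : A) (u : seq (R[i] * X)) :
  let t := in_tuple u in
  \sum_(q <- u) Num.conj q.1 *
    (\sum_(p <- u) p.1 * dotp (psi (star q.2.1 * b * p.2.1) p.2.2) q.2.2) =
  \sum_i \sum_j dotp
    (psi (star ((tnth t i).1 *: (tnth t i).2.1) * b *
          ((tnth t j).1 *: (tnth t j).2.1)) (tnth t j).2.2) (tnth t i).2.2.
Proof.
move=> t; rewrite big_tnth; apply: eq_bigr => i _; rewrite big_tnth mulr_sumr.
by apply: eq_bigr => j _; rewrite starZ !mulZl mulZr !(cpZ psiCP) !bopZE !dotpZl.
Qed.

Lemma stinespring_psd : psd_kernel k.
Proof.
move=> u; have := gram_cp 1 u; rewrite /pairing /comb /k => E.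
under eq_bigr do under [X in _ * X]eq_bigr do rewrite -[star _]mulr1.
rewrite E; under eq_bigr do under eq_bigr do rewrite mulr1.
by have [_] := (completely_positiveE psi).1 psiCP; exact.
Qed.

(** As a function of b, this is the positive functional to which the estimate
    g(c^* c) <= |c|^2 g(1) is applied to bound the translation by c. *)
Let g (u : seq (R[i] * X)) (b : A) : R[i] :=
  \sum_(q <- u) Num.conj q.1 *
    (\sum_(p <- u) p.1 * dotp (psi (star q.2.1 * b * p.2.1) p.2.2) q.2.2).

Let gD u a b : g u (a + b) = g u a + g u b.
Proof.
rewrite /g -big_split; apply: eq_bigr => q _ /=; rewrite -mulrDr -big_split.
congr (_ * _); apply: eq_bigr => p _ /=.
by rewrite mulrDr mulrDl (cpD psiCP) bopDE dotpDl mulrDr.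
Qed.

Let gZ u (c : R[i]) b : g u (c *: b) = c * g u b.
Proof.
rewrite /g mulr_sumr; apply: eq_bigr => q _; rewrite [RHS]mulrCA [c * _]mulr_sumr.
congr (_ * _); apply: eq_bigr => p _.
by rewrite mulZr mulZl (cpZ psiCP) bopZE dotpZl [RHS]mulrCA.
Qed.

Let g_ge0 u b : 0 <= g u (star b * b).
Proof.
rewrite /g gram_cp; have [_ pos] := (completely_positiveE psi).1 psiCP.
have := pos _ (fun i =>
  b * ((tnth (in_tuple u) i).1 *: (tnth (in_tuple u) i).2.1))
  (fun i => (tnth (in_tuple u) i).2.2); rewrite /cp_form.
under eq_bigr do under eq_bigr do rewrite starMul mulrA -[star _ * star _ *
  _]mulrA.
exact.
Qed.

Definition shift_comb (c : A) (u : seq (R[i] * X)) : seq (R[i] * X) :=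
  [seq (p.1, (c * p.2.1, p.2.2)) | p <- u].

(** This is the inequality |sigma(c)w| <= |c| |w| on finite combinations w. *)
Lemma gram_shift c u : complex.Re (pairing (comb k (shift_comb c u))
  (shift_comb c u))
  <= rnorm c ^+ 2 * complex.Re (pairing (comb k u) u).
Proof.
have -> : pairing (comb k (shift_comb c u)) (shift_comb c u) = g u (star c * c).
  rewrite /pairing /comb /g /k big_map; apply: eq_bigr => q _; rewrite big_map /=.
  by congr (_ * _); apply: eq_bigr => p _; rewrite starMul !mulrA.
have -> : pairing (comb k u) u = g u 1.
  by apply: eq_bigr => q _; congr (_ * _); apply: eq_bigr => p _; rewrite mulr1.
apply: (@positive_functional_bound _ _ (fun b => complex.Re (g u b))) =>
  [a b|t b|b].
- by rewrite gD raddfD.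
- by rewrite gZ ReZ.
- by have := g_ge0 u b; rewrite lecE => /andP[].
Qed.

Local Notation K := (rkhs stinespring_psd).

Let pairing_shift (f : A * H -> R[i]) c u :
  pairing (fun p => f (c * p.1, p.2)) u = pairing f (shift_comb c u).
Proof. by rewrite /pairing big_map. Qed.

Let gram_norm u : Num.sqrt (complex.Re (pairing (comb k u) u)) =
  rnorm (rkhs_comb stinespring_psd u).
Proof.
rewrite -[pairing _ u]/(pairing (rkhs_comb stinespring_psd u) u) -dotp_comb.
by rewrite -/(rdot _ _) rdotxx sqrtr_sqr ger0_norm ?rnorm_ge0.
Qed.

Let Re_pairing (f : K) u : complex.Re (pairing f u) <=
  rnorm f * Num.sqrt (complex.Re (pairing (comb k u) u)).
Proof.
rewrite gram_norm -dotp_comb -/(rdot _ _); apply: le_trans (rdot_CS _ _).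
exact: ler_norm.
Qed.

Let shift_bound (f : K) c u : complex.Re (pairing (fun p =>
  f (c * p.1, p.2)) u) <=
  rnorm c * rnorm f * Num.sqrt (complex.Re (pairing (comb k u) u)).
Proof.
rewrite pairing_shift; apply: le_trans (Re_pairing _ _) _.
rewrite [rnorm c * _]mulrC -mulrA; apply: ler_wpM2l; first exact: rnorm_ge0.
rewrite -[rnorm c]ger0_norm ?rnorm_ge0 // -sqrtr_sqr -sqrtrM ?sqr_ge0 //.
by rewrite ler_wsqrtr // gram_shift.
Qed.

Let shift_kbounded (f : K) c : (fun p => f (c * p.1, p.2)) \in kbounded k.
Proof.
apply/asboolP; exists (rnorm c * rnorm f); split; last exact: shift_bound.
by rewrite mulr_ge0 ?rnorm_ge0.
Qed.

Let shift c (f : K) : K := Rkhs stinespring_psd (shift_kbounded f c).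

Let rkhsP (f h : K) : (forall a x, f (a, x) = h (a, x)) -> f = h.
Proof. by move=> e; apply: val_inj; apply/funext => -[a x]; exact: e. Qed.

Let shift_bl c : shift c \in @bounded_linear R K K.
Proof.
apply/asboolP; split=> [t f h|]; first by apply: rkhsP.
exists (rnorm c)%:C%C => f; rewrite !rnormE -rmorphM lecR.
apply: rkhs_norm_le; first by rewrite mulr_ge0 ?rnorm_ge0.
exact: shift_bound.
Qed.

(** Since f(a, x) = <f, sigma(a)Vx>, the operator sigma(c) translates the first
    argument by c^*. Given on functions, it is defined on the whole space with
    no extension by density. *)
Definition stinespring_rep (c : A) : 'B(K) := BoundedOp (shift_bl (star c)).
Local Notation sigma := stinespring_rep.

Let sigmaE c f a x : sigma c f (a, x) = f (star c * a, x). Proof. by []. Qed.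

(** The vector sigma(a)Vx. *)
Definition stinespring_vec (a : A) (x : H) : K :=
  rkhs_comb stinespring_psd [:: (1, (a, x))].
Local Notation e := stinespring_vec.

Let eE a x b y : e a x (b, y) = dotp (psi (star b * a) x) y.
Proof. by rewrite /e /= /comb big_seq1 mul1r. Qed.

Let dotp_e (f : K) a x : dotp f (e a x) = f (a, x).
Proof. by rewrite dotp_comb /pairing big_seq1 rmorph1 mul1r. Qed.

Let eZD (c : R[i]) a b x : e (c *: a + b) x = c *: e a x + e b x.
Proof.
apply: rkhsP => d y; rewrite -[RHS]/(c * e a x (d, y) + e b x (d, y)) !eE.
by rewrite mulrDr mulZr (cp_linear psiCP) bopDE bopZE dotpDl dotpZl.
Qed.

Let sigma_e c a x : sigma c (e a x) = e (c * a) x.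
Proof. by apply: rkhsP => b y; rewrite sigmaE !eE starMul starK mulrA. Qed.

Lemma stinespring_representation : representation sigma.
Proof.
split.
- move=> c a b; apply/bopP => f; apply: rkhsP => d y.
  rewrite sigmaE -[RHS]/(c * f (star a * d, y) + f (star b * d, y)) -!dotp_e.
  by rewrite starD starZ mulrDl mulZl eZD dotpDr dotpZr conjCK.
- split=> [|a b]; apply/bopP => f; apply: rkhsP => d y.
    by rewrite sigmaE star1 mul1r.
  by rewrite !sigmaE starMul mulrA.
- move=> c; apply/bopP => f; apply: rkhsP => a x.
  rewrite -[RHS]dotp_e [RHS]dotpC -adjointP -dotpC sigma_e dotp_e.
  by rewrite sigmaE starK.
Qed.

Hypothesis psi1 : psi 1 = 1.

Let norm_e1 x : `|e 1 x| = `|x|.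
Proof.
apply/eqP; rewrite -(@eqrXn2 _ 2) // -!dotp_norm dotp_e eE star1 mul1r.
by rewrite psi1.
Qed.

Let dilation_bl : e 1 \in @bounded_linear R H K.
Proof.
apply/asboolP; split=> [c x y|]; last by exists 1 => x; rewrite norm_e1 mul1r.
apply: rkhsP => a z; rewrite -[RHS]/(c * e 1 x (a, z) + e 1 y (a, z)) !eE.
by rewrite linearP dotpDl dotpZl.
Qed.

(** The last clause is minimality: the vectors sigma(a)Vx are total. *)
Theorem stinespring_dilation : exists (K : hilbertType R) (sigma : A ->
  'B(K)) (V : 'B(H, K)),
  [/\ representation sigma, isometric V,
      forall a x y, dotp (sigma a (V x)) (V y) = dotp (psi a x) y &
      forall f : K, (forall a x, dotp f (sigma a (V x)) = 0) -> f = 0].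
Proof.
exists (K : hilbertType R), sigma, (BoundedOp dilation_bl); split.
- exact: stinespring_representation.
- exact: norm_e1.
- by move=> a x y; rewrite /= dotp_e sigmaE mulr1 eE starK mulr1.
- move=> f f0; apply: rkhsP => a x; rewrite -dotp_e.
  have e0 : dotp f (sigma a (e 1 x)) = 0 := f0 a x.
  by move: e0; rewrite sigma_e mulr1.
Qed.

End Stinespring.

(** * Purity, irreducibility and unitary equivalence *)

Section IrreducibleDilation.
Variables (R : realType) (A : cstarType R) (H K : hilbertType R).
Variables (psi : A -> 'B(H)) (sigma : A -> 'B(K)) (V : 'B(H, K)).
Hypotheses (sigmaR : representation sigma) (Viso : isometric V).
Hypothesis psiE : forall a x y, dotp (sigma a (V x)) (V y) = dotp (psi a x) y.
Hypothesis Vcyclic : forall f : K, (forall a x, dotp f (sigma a (V x)) = 0) ->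
  f = 0.
Hypothesis psi_pure : forall xi : A -> 'B(H), completely_positive setT xi ->
  completely_positive setT (psi \- xi) ->
  exists t : R, forall a, xi a = t%:C%C *: psi a.

(** If 0 <= P <= 1 commutes with sigma, then V^* P sigma V is dominated by psi,
    hence equal to t psi; on the total set of the sigma(a)Vx this means
    P = t. *)
Lemma commutant_trivial (P : 'B(K)) : (forall a, P * sigma a = sigma a * P) ->
    (forall w, 0 <= dotp (P w) w) -> (forall w, 0 <= dotp (w - P w) w) ->
  exists t : R, forall w, P w = t%:C%C *: w.
Proof.
move=> Pc P0 P1; have PE c v : P (sigma c v) = sigma c (P v).
  by have := congr1 (fun U : 'B(K) => U v) (Pc c).
have dCP : completely_positive setT (psi \- compression sigma V P).
  have -> : psi \- compression sigma V P = compression sigma V (1 - P).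
    apply/funext => a; apply/bopP => x; apply: dotp_injr => z.
    rewrite [LHS]dotpC [RHS]dotpC; congr (Num.conj _).
    by rewrite dotp_compression !bopBE !dotpBl -psiE dotp_compression.
  apply: compression_cp => // a.
  by rewrite mulrBl mulrBr mul1r mulr1 Pc.
have [t tE] := psi_pure (compression_cp sigmaR V Pc P0) dCP.
exists t.
have Pself v w : dotp (P v) w = dotp v (P w).
  have im u : complex.Im (dotp (P u) u) = 0 by have := P0 u;
    rewrite lecE => /andP[/eqP].
  have := im v; have := im w; have := im (v + w); have := im (v + 'i%C *: w).
  have PD u u' : P (u + u') = P u + P u' by exact: raddfD.
  have PZ c u : P (c *: u) = c *: P u by exact: linearZ.
  rewrite !PD PZ !dotpDl !dotpDr !dotpZl !dotpZr [dotp v (P w)]dotpC.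
  case: (dotp (P v) v) (dotp (P v) w) (dotp (P w) v) (dotp (P w) w)
    => a b [a' b'] [c d] [c' d'] /= *.
  by apply/eqP; rewrite eq_complex /=; apply/andP; split; apply/eqP; lra.
have Pgen a x : P (sigma a (V x)) = t%:C%C *: sigma a (V x).
  apply/eqP; rewrite -subr_eq0; apply/eqP; apply: Vcyclic => b y.
  rewrite dotpBl dotpZl PE -!(representation_dotp sigmaR) -PE.
  by rewrite -dotp_compression tE bopZE dotpZl psiE subrr.
move=> w; apply/eqP; rewrite -subr_eq0; apply/eqP; apply: Vcyclic => a x.
by rewrite dotpBl Pself Pgen dotpZr dotpZl conj_Creal ?subrr // complex_real.
Qed.

(** The projection onto an invariant subspace commutes with sigma, as the
    orthogonal complement is invariant too; being a scalar, it is 0 or 1. The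
    vector x0 ensures that the space is not 0. *)
Lemma irreducible_dilation (x0 : H) : x0 != 0 -> irreducible sigma.
Proof.
move=> x00; have [_ _ sS] := sigmaR; split=> //.
  by exists (V x0); rewrite -normr_eq0 Viso normr_eq0.
move=> M Mlin Mcl Minv; have [P [MP Pp Puniq]] := orthogonal_projection Mlin Mcl.
have Pc a : P * sigma a = sigma a * P.
  apply/bopP => v /=; apply: Puniq => [|m Mm]; first exact/Minv/MP.
  rewrite -raddfB /=.
  have -> : sigma a = adjoint (sigma (star a)) by rewrite -sS starK.
  by rewrite dotpC -adjointP dotpC conjCK Pp ?rmorph0 //; exact: Minv.
have PP w : dotp (P w) w = dotp (P w) (P w).
  have := Pp w (P w) (MP w); rewrite dotpBl [dotp w _]dotpC => /eqP.
  rewrite subr_eq0 => /eqP e; rewrite -[LHS]conjCK e.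
  by rewrite [RHS]dotpC.
have P0 w : 0 <= dotp (P w) w by rewrite PP dotp_norm exprn_ge0.
have P1 w : 0 <= dotp (w - P w) w.
  have -> : dotp (w - P w) w = dotp (w - P w) (w - P w).
    by rewrite [RHS]dotpBr (Pp w (P w) (MP w)) subr0.
  by rewrite dotp_norm exprn_ge0.
have [t tE] := commutant_trivial Pc P0 P1.
have PM m : M m -> P m = m.
  by move=> Mm; apply: Puniq => // m' _; rewrite subrr linear0l.
have [M0|/existsNP[m /not_implyP[Mm m0]]] := pselect (forall m, M m -> m = 0).
  left; apply/seteqP; split=> [m /M0 //|_ ->].
  by apply: set_mem; exact: Mlin.1.
right; apply/seteqP; split=> // w _.
have t1 : t%:C%C = 1 :> R[i].
  have := tE m; rewrite PM // => /eqP; rewrite -subr_eq0 -{1}[m]scale1r -scalerBl.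
  by rewrite scaler_eq0 subr_eq0 => /orP[/eqP //|/eqP].
by have := MP w; rewrite tE t1 scale1r.
Qed.

End IrreducibleDilation.

Section PureExtensions.
Variables (R : realType) (A : cstarType R) (H : hilbertType R).
Variables (S : set A) (pi : A -> 'B(H)).

(** Write psi = xi + eta; purity gives xi = t pi on S. If t is 0 or 1, then xi or
    eta vanishes at 1, hence everywhere ([cp_eq0]). Otherwise xi / t and
    eta / (1 - t) are extensions of pi|S between which psi lies. *)
Lemma extreme_extension_pure psi :
    submod_closed (mem S) -> 1 \in S -> pure S pi ->
    extreme_in (@matrix_coefs R A H @` cp_extensions S pi) (matrix_coefs psi) ->
  forall xi, completely_positive setT xi ->
    completely_positive setT (psi \- xi) ->
  exists t : R, forall a, xi a = t%:C%C *: psi a.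
Proof.
move=> Slin S1 [[_ pi1] pi_pure] [[psi' psiE' e] ext] xi xiCP dCP.
have {psi' psiE' e} psiE : cp_extensions S pi psi
  by rewrite -(matrix_coefs_inj e).
have psi1 : psi 1 = 1 by rewrite psiE.2.
have [t [/andP[t0 t1] tE]] : exists t : R, 0 <= t <=
  1 /\ {in S, forall s, xi s = t%:C%C *: pi s}.
  apply: pi_pure; first exact: completely_positive_sub.
  apply: eq_completely_positive Slin _ (completely_positive_sub S dCP).
  by move=> s sS; rewrite /= psiE.2.
exists t; have [tz|tn0] := eqVneq t 0.
  have xi0 : xi = (fun=> 0) by apply: cp_eq0 => //; rewrite tE // tz scale0r.
  by move=> a; rewrite xi0 tz scale0r.
have [to|tn1] := eqVneq t 1.
  have d0 : psi \- xi = (fun=> 0).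
    by apply: cp_eq0 => //=; rewrite tE // to scale1r pi1 psi1 subrr.
  move=> a; rewrite to scale1r; apply/esym/eqP; rewrite -subr_eq0; apply/eqP.
  exact: (congr1 (fun f => f a) d0).
have tp : 0 < t by rewrite lt_def tn0.
have tl : t < 1 by rewrite lt_def eq_sym tn1.
have t1p : 0 < 1 - t by rewrite subr_gt0.
pose xi1 a := t^-1%:C%C *: xi a; pose xi2 a := (1 - t)^-1%:C%C *: (psi \- xi) a.
have E1 : cp_extensions S pi xi1.
  split; first by apply: completely_positiveZ => //; rewrite invr_ge0.
  move=> s sS; rewrite /xi1 tE // scalerA -rmorphM mulVf // rmorph1 scale1r //.
have E2 : cp_extensions S pi xi2.
  split; first by apply: completely_positiveZ => //; rewrite invr_ge0 ltW.
  move=> s sS; rewrite /xi2 /= tE // psiE.2 // -{1}[pi s]scale1r -scalerBl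
    scalerA.
  rewrite -(rmorph1 (real_complex R)) -rmorphB -rmorphM mulVf ?gt_eqF //
    scale1r //.
have [||||e1 _] := ext t (matrix_coefs xi1) (matrix_coefs xi2).
- by rewrite tp.
- by exists xi1.
- by exists xi2.
- apply/funext => -[[a x] y]; rewrite /convex_comb /matrix_coefs /xi1 /xi2.
  rewrite -[(psi \- xi) _]/(psi a - xi a) !bopZE bopBE !rdotZl !mulrA !divff
    ?gt_eqF // !mul1r.
  by rewrite rdotDl rdotNl addrC subrK.
move=> a; rewrite -(matrix_coefs_inj e1) /xi1 scalerA -rmorphM divff //.
by rewrite rmorph1 scale1r.
Qed.

End PureExtensions.

Section Unitary.
Variables (R : realType) (H K : hilbertType R).

(** By polarization, the norms determine the inner products. *)
Lemma isometric_dotp (U : 'B(H, K)) : isometric U ->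
  forall x y, dotp (U x) (U y) = dotp x y.
Proof.
move=> Ui; have rn x : rnorm (U x) = rnorm x by rewrite /rnorm Ui.
have rd x y : rdot (U x) (U y) = rdot x y.
  by have := rnorm2D (U x) (U y); rewrite -raddfD !rn rnorm2D; lra.
by move=> x y; rewrite !dotpE -linearZ /= !rd.
Qed.

Lemma adjoint_isometric (U : 'B(H, K)) : isometric U ->
  forall x, adjoint U (U x) = x.
Proof.
by move=> Ui x; apply: dotp_injr => z; rewrite -adjointP isometric_dotp.
Qed.

End Unitary.

(** * Weak peak points that are boundary representations *)

(** pi is its own compression by the identity. *)
Lemma representation_cp (R : realType) (A : cstarType R) (H : hilbertType R)
  (pi : A -> 'B(H)) : representation pi -> completely_positive setT pi.
Proof.
move=> piR; have -> : pi = compression pi (bop_id H) (bop_id H).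
  by apply/funext => a; apply/bopP => x; apply: dotp_injr => z;
    rewrite /= -adjointP.
have c1 a : bop_id H * pi a = pi a * bop_id H by apply/bopP.
apply: (compression_cp piR _ c1) => w; by rewrite dotp_norm exprn_ge0.
Qed.

Theorem theorem5p2 (R : realType) (A : cstarType R) (S : set A)
  (H : hilbertType R) (pi : A -> 'B(H)) :
  operator_system S ->
  irreducible pi ->
  weak_peak_point S pi ->
  weak_boundary_representation S pi ->
  pure S pi ->
  boundary_representation S pi.
Proof.
move=> [Slin _ S1 _] piI [_ [s sS [[x0 x01 peak] nopeak]]] [_ wbd] piP.
have [piR [h0 h00 _]] := piI; have piCP := representation_cp piR.
have pi1 : pi 1 = 1 by case: piR => _ [].
split=> //; split=> [|psi0 [psi0CP psi0E]]; first by split.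
pose E := @matrix_coefs R A H @` cp_extensions S pi.
(* one inequality is enough: the other one is the same at the coefficient of -y *)
have key p : matrix_coefs psi0 p <= matrix_coefs pi p.
  have Ec : compact (E : set {ptws _ -> R}) by exact: cp_extensions_compact.
  have E0 : E !=set0 by exists (matrix_coefs pi), pi; split.
  have [_ [[psi psiE <-] ext] pmax] :=
    @extreme_point_max R (A * H * H)%type E p Ec E0.
  suff <- : psi = pi by apply: pmax; exists psi0.
  have psi1 : psi 1 = 1 by rewrite psiE.2.
  have psi_ext : extreme_in E (matrix_coefs psi) by split=> //; exists psi.
  have psi_pure := extreme_extension_pure Slin S1 piP psi_ext.
  have [K [sigma [V [sR Vi Vpsi Vcyc]]]] := stinespring_dilation psiE.1 psi1.
  have sI := irreducible_dilation sR Vi Vpsi Vcyc psi_pure h00.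
  have [U [Ui Uonto Uc]] : unitarily_equivalent pi sigma.
    apply: contrapT => /(nopeak _ _ sI)/(_ (V x0)).
    by rewrite Vi Vpsi psiE.2 // peak ltxx => /(_ x01).
  pose W := bop_comp (adjoint U) V.
  have UW x : U (W x) = V x.
    have [h _ hV] : range U (V x) by rewrite Uonto.
    by rewrite /W /= -hV adjoint_isometric.
  have WE a : adjoint W * pi a * W = psi a.
    apply/bop_rdotP => x y; rewrite /rdot; congr complex.Re.
    rewrite [LHS]dotpC -adjointP -dotpC -(isometric_dotp Ui) !UW -Vpsi -(UW x).
    by have -> : U (pi a (W x)) = sigma a (U (W x))
      by have := congr1 (fun f : 'B(H, K) => f (W x)) (Uc a).
  have Wi : isometric W by move=> x; rewrite -Ui UW Vi.
  apply/funext => a; rewrite -WE; apply: wbd => // t tS.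
  by rewrite WE psiE.2.
apply: matrix_coefs_inj; apply/funext => -[[a x] y]; apply/eqP;
  rewrite eq_le key andbT.
by have := key (a, x, - y); rewrite /matrix_coefs /= !rdotNr lerN2.
Qed.
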